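(* Let $d\ge3$ and let $X=(X_t)$ be an isotropic unimodal Lévy process in $\mathbb{R}^d$ with characteristic exponent $\psi\not\equiv0$ and potential kernel $G(x)$. There exists a constant $C_4$ depending only on $d$ such that $$G(x)\le\frac{C_4}{|x|^d\,\psi^*(|x|^{-1})},\qquad x\in\mathbb{R}^d\setminus\{0\}.$$ If additionally $\psi$ satisfies WLSC$(\beta,R^{-1},C^* )$, where $R\in(0,\infty]$ (with $\infty^{-1}=0$), $\beta>0$, $C^*>0$, then $$\frac{C_5}{|x|^d\,\psi^*(|x|^{-1})}\le G(x),\qquad 0<|x|\le bR,$$ where $b=c(d,\beta)\,(C^* )^{1/\beta}<1$ and $C_5=c(d)\,b^d$, with $c(d,\beta)>0$ depending only on $d,\beta$ and $c(d)>0$ depending only on $d$.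
   Context: The characteristic exponent is defined by $E^0e^{i\langle\xi,X_t\rangle}=e^{-t\psi(\xi)}$. A measure $m$ on $\mathbb{R}^d$ is isotropic unimodal if there is a non-increasing $m_0:(0,\infty)\to[0,\infty)$ with $m(dx)=m_0(|x|)dx$ on $\mathbb{R}^d\setminus\{0\}$ (an atom at $0$ is allowed); $X$ is isotropic unimodal if $P^0(X_t\in dx)$ is isotropic unimodal for every $t>0$ (then $\psi$ is real and radial). $\psi^*(u)=\sup_{|x|\le u}\psi(x)$. A positive function $f$ on $\mathbb{R}^d\setminus\{0\}$ satisfies WLSC$(\beta,\theta,C)$ if $f(\lambda x)\ge C\lambda^\beta f(x)$ for all $\lambda\ge1$ and $x\neq0$ with $|x|\ge\theta$. For $d\ge3$ the process is transient; its potential measure $G(A)=E^0\int_0^\infty\mathbf 1_A(X_t)dt$ is isotropic unimodal, and the potential kernel $G(x)$, $x\ne0$, is the (radially non-increasing) density of its absolutely continuous part. *)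

(* Defs.v *)
From HB Require Import structures.
From mathcomp Require Import all_boot all_order all_algebra.
From mathcomp Require Import complex.
From mathcomp Require Import all_classical all_reals all_analysis.
Import Order.TTheory GRing.Theory Num.Theory.
Import numFieldNormedType.Exports.

Set Implicit Arguments.
Unset Strict Implicit.
Unset Printing Implicit Defensive.

Local Open Scope classical_set_scope.
Local Open Scope ring_scope.

Definition rV_display : measure_display. Proof. exact. Qed.

Section borel_rV.
Context (R : realType) (n : nat).

Definition rV_coord (i : 'I_n) (x : 'rV[R]_n) : measurableTypeR R := x ord0 i.

Let rV0 : g_sigma_preimage rV_coord set0.
Proof. exact: sigma_algebra0. Qed.

Let rVC A : g_sigma_preimage rV_coord A -> g_sigma_preimage rV_coord (~` A).
Proof. exact: sigma_algebraC. Qed.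

Let rV_bigcup (F : (set 'rV[R]_n)^nat) :
  (forall i, g_sigma_preimage rV_coord (F i)) ->
  g_sigma_preimage rV_coord (\bigcup_i F i).
Proof. exact: sigma_algebra_bigcup. Qed.

(* The product sigma-algebra, i.e. the Borel sigma-algebra of R^n. *)
HB.instance Definition _ := @isMeasurable.Build rV_display
  'rV[R]_n (g_sigma_preimage rV_coord) rV0 rVC rV_bigcup.

End borel_rV.

Lemma measurable_rV_coord (R : realType) n (i : 'I_n) :
  measurable_fun [set: 'rV[R]_n] (@rV_coord R n i).
Proof.
move=> _ Y mY; rewrite setTI; apply: sub_sigma_algebra => /=.
rewrite -bigcup_seq/=; exists i => /=; first by rewrite mem_index_enum.
by exists Y => //; rewrite setTI.
Qed.

Lemma measurable_fun_rVP d (T : measurableType d) (R : realType) n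
    (f : T -> 'rV[R]_n) :
  measurable_fun [set: T] f <->
  forall i, measurable_fun [set: T] (rV_coord i \o f).
Proof.
split=> [mf i|mf].
  exact: measurableT_comp (measurable_rV_coord i) mf.
rewrite /measurable_fun => _ A mA; rewrite setTI.
suff : g_sigma_preimage (fun i => @rV_coord R n i \o f) `<=` measurable.
  apply; rewrite g_sigma_preimage_comp; exists A => //.
  by rewrite setTI.
apply: smallest_sub; first exact: sigma_algebra_measurable.
rewrite -bigcup_seq => B [i _ [C mC <-]].
exact: mf.
Qed.

Section rV_cons.
Context (R : realType) (n : nat).

Definition rV_cons (p : measurableTypeR R * 'rV[R]_n) : 'rV[R]_n.+1 :=
  row_mx (p.1 : R)%:M p.2.

Lemma rV_cons0 p : rV_coord ord0 (rV_cons p) = p.1.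
Proof.
rewrite /rV_coord (_ : ord0 = lshift n (ord0 : 'I_1)); last exact/val_inj.
by rewrite (@row_mxEl _ 1 1 n) mxE eqxx.
Qed.

Lemma rV_consS p i : rV_coord (lift ord0 i) (rV_cons p) = rV_coord i p.2.
Proof.
rewrite /rV_coord (_ : lift ord0 i = rshift 1 i); last exact/val_inj.
by rewrite (@row_mxEr _ 1 1 n).
Qed.

Lemma measurable_rV_cons : measurable_fun setT rV_cons.
Proof.
apply/measurable_fun_rVP => i; case: (unliftP ord0 i) => [j|] ->.
- rewrite (_ : _ \o _ = rV_coord j \o snd).
    exact: measurableT_comp (measurable_rV_coord j) measurable_snd.
  by apply/funext => p /=; rewrite rV_consS.
- rewrite (_ : _ \o _ = fst); first exact: measurable_fst.
  by apply/funext => p /=; rewrite rV_cons0.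
Qed.

Lemma measurable_rsubmx :
  measurable_fun setT (fun y : 'rV[R]_n.+1 => rsubmx (y : 'rV[R]_(1 + n))).
Proof.
apply/measurable_fun_rVP => i.
rewrite (_ : _ \o _ = rV_coord (rshift 1 i : 'I_n.+1)).
  exact: measurable_rV_coord.
by apply/funext => y /=; rewrite /rV_coord mxE.
Qed.

Definition lebesgue_rV_succ (mu : {sigma_finite_measure set 'rV[R]_n -> \bar R})
    : set 'rV[R]_n.+1 -> \bar R :=
  pushforward (lebesgue_measure \x mu)%E rV_cons.

Variable mu : {sigma_finite_measure set 'rV[R]_n -> \bar R}.

Local Notation nu := (lebesgue_rV_succ mu).

Let measurable_preimage_cons A : measurable A -> measurable (@rV_cons @^-1` A).
Proof. by move=> mA; rewrite -[X in measurable X]setTI; exact: measurable_rV_cons. Qed.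

Let nu0 : nu set0 = 0%E.
Proof. by rewrite /lebesgue_rV_succ /pushforward preimage_set0 measure0. Qed.

Let nu_ge0 A : (0 <= nu A)%E.
Proof. by rewrite /lebesgue_rV_succ /pushforward; apply: integral_ge0. Qed.

Let nu_sigma_additive : semi_sigma_additive nu.
Proof.
move=> F mF tF mUF; rewrite /lebesgue_rV_succ /pushforward preimage_bigcup.
apply: measure_semi_sigma_additive.
- by move=> k; exact: measurable_preimage_cons.
- apply/trivIsetP => /= i j _ _ ij; rewrite -preimage_setI.
  by move/trivIsetP : tF => /(_ _ _ _ _ ij) ->//; rewrite preimage_set0.
- by rewrite -preimage_bigcup; exact: measurable_preimage_cons.
Qed.

HB.instance Definition _ := isMeasure.Build _ _ _ nu nu0 nu_ge0 nu_sigma_additive.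

Let nu_sigma_finite : sigma_finite setT nu.
Proof.
have /sigma_finiteP[F [TF ndF Foo]] := sigma_finiteT (@lebesgue_measure R).
have /sigma_finiteP[G [TG ndG Goo]] := sigma_finiteT mu.
pose uncons (y : 'rV[R]_n.+1) : measurableTypeR R * 'rV[R]_n :=
  (rV_coord ord0 y, rsubmx (y : 'rV[R]_(1 + n))).
have muncons : measurable_fun setT uncons.
  apply/measurable_fun_pairP; split.
    exact: measurable_rV_coord.
  exact: measurable_rsubmx.
have rV_consKV p : uncons (rV_cons p) = p.
  case: p => a v; congr pair; [exact: rV_cons0|exact: row_mxKr].
exists (fun k => uncons @^-1` (F k `*` G k)).
  rewrite predeqE => y; split=> // _.
  have [k _ Fk] : (\bigcup_i F i) (uncons y).1 by rewrite -TF.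
  have [l _ Gl] : (\bigcup_i G i) (uncons y).2 by rewrite -TG.
  exists (maxn k l) => //; split.
  - by move: Fk; exact/subsetPset/ndF/leq_maxl.
  - by move: Gl; exact/subsetPset/ndG/leq_maxr.
move=> k; have [mFk Fkoo] := Foo k; have [mGk Gkoo] := Goo k; split.
  by rewrite -[X in measurable X]setTI; apply: muncons => //; exact: measurableX.
rewrite /lebesgue_rV_succ /pushforward -comp_preimage.
rewrite (_ : uncons \o _ = id); last exact/funext.
by rewrite preimage_id product_measure1E// lte_mul_pinfty// ge0_fin_numE.
Qed.

HB.instance Definition _ := Measure_isSigmaFinite.Build _ _ _ nu nu_sigma_finite.

End rV_cons.

(* Lebesgue measure on R^n, as an iterated product measure. *)
Fixpoint lebesgue_rV (R : realType) (n : nat) :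
    {sigma_finite_measure set 'rV[R]_n -> \bar R} :=
  if n is k.+1 then lebesgue_rV_succ (lebesgue_rV R k) else \d_(0 : 'rV[R]_0).

Lemma lebesgue_rV_box (R : realType) n (A : 'I_n -> set (measurableTypeR R)) :
  (forall i, measurable (A i)) ->
  lebesgue_rV R n [set x | forall i, A i (rV_coord i x)] =
  (\prod_(i < n) lebesgue_measure (A i))%E.
Proof.
elim: n A => [A _|n IHn A mA].
  rewrite big_ord0 /= diracE mem_set//= => i; by case: i.
have mB : measurable
    [set x : 'rV[R]_n | forall i, A (lift ord0 i) (rV_coord i x)].
  rewrite (_ : mkset _ =
      \bigcap_(i : 'I_n) (rV_coord i @^-1` A (lift ord0 i))); last first.
    by apply/seteqP; split=> [x Ax i _|x Ax i]; exact: Ax.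
  apply: fin_bigcap_measurable => [|i _]; first exact: finite_finset.
  by rewrite -[X in measurable X]setTI; apply: measurable_rV_coord.
rewrite big_ord_recl -(IHn (A \o lift ord0)); last by move=> i; exact: mA.
rewrite -product_measure1E//= /lebesgue_rV_succ /pushforward.
congr (_ _); apply/seteqP; split=> -[a v] /=.
- move=> Aav; split=> [|i]; first by have := Aav ord0; rewrite rV_cons0.
  by have := Aav (lift ord0 i); rewrite rV_consS.
- move=> [Aa Av] i; case: (unliftP ord0 i) => [j|] ->.
    by rewrite rV_consS; exact: Av.
  by rewrite rV_cons0.
Qed.

Section euclidean.
Context (R : realType) (d : nat).
Implicit Types x y : 'rV[R]_d.

Definition inner x y : R := \sum_(i < d) x ord0 i * y ord0 i.

(* [`|x|] on ['rV[R]_d] is the sup norm. *)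
Definition eucl_norm x : R := Num.sqrt (inner x x).

End euclidean.

Section levy.
Context (R : realType) (d : nat).
Context (disp : measure_display) (Omega : measurableType disp).
Variable P : probability Omega R.

Definition independent_rvs n (Y : 'I_n -> Omega -> 'rV[R]_d) : Prop :=
  forall B : 'I_n -> set 'rV[R]_d, (forall i, measurable (B i)) ->
    P [set w | forall i, B i (Y i w)] = (\prod_(i < n) P (Y i @^-1` B i))%E.

Definition cadlag (f : R -> 'rV[R]_d) : Prop :=
  (forall t, 0 <= t -> f s @[s --> t^'+] --> f t) /\
  (forall t, 0 < t -> cvg (f s @[s --> t^'-])).

(* Only the times [t >= 0] matter. *)
Record levy_process (X : R -> Omega -> 'rV[R]_d) : Prop := {
  levy_measurable : forall t, 0 <= t -> measurable_fun setT (X t) ;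
  levy_start : {ae P, forall w, X 0 w = 0} ;
  levy_independent : forall n (t : nat -> R), 0 <= t 0%N ->
    (forall i, (i < n)%N -> t i < t i.+1) ->
    independent_rvs (fun (i : 'I_n) w => X (t i.+1) w - X (t i) w) ;
  levy_stationary : forall s t, 0 <= s -> 0 <= t ->
    forall A, measurable A ->
    P ((fun w => X (s + t) w - X s w) @^-1` A) =
    P ((fun w => X t w - X 0 w) @^-1` A) ;
  levy_stoch_continuous : forall t e, 0 <= t -> 0 < e ->
    P [set w | e < eucl_norm (X s w - X t w)]
      @[s --> within [set s | 0 <= s] (nbhs t)] --> 0%E ;
  levy_cadlag : {ae P, forall w, cadlag (X ^~ w)} }.

Definition unimodal_profile (m0 : R -> R) : Prop :=
  (forall r, 0 < r -> 0 <= m0 r) /\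
  (forall r s, 0 < r -> r <= s -> m0 s <= m0 r).

Definition isotropic_unimodal (m : set 'rV[R]_d -> \bar R) : Prop :=
  exists2 m0 : R -> R, unimodal_profile m0 &
    forall A : set 'rV[R]_d, measurable A -> ~ A 0 ->
      m A = (\int[lebesgue_rV R d]_(x in A) (m0 (eucl_norm x))%:E)%E.

Definition isotropic_unimodal_process (X : R -> Omega -> 'rV[R]_d) : Prop :=
  forall t, 0 < t -> isotropic_unimodal (pushforward P (X t)).

Definition charfun (Y : Omega -> 'rV[R]_d) (xi : 'rV[R]_d) : R[i] :=
  ((\int[P]_w cos (inner xi (Y w))) +i* (\int[P]_w sin (inner xi (Y w))))%C.

(* Isotropic unimodal processes are symmetric, hence the real-valued [psi]. *)
Definition char_exponent (X : R -> Omega -> 'rV[R]_d) (psi : 'rV[R]_d -> R) :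
    Prop :=
  forall t xi, 0 <= t -> charfun (X t) xi = (expR (- t * psi xi))%:C%C.

Definition potential_measure (X : R -> Omega -> 'rV[R]_d)
    (A : set 'rV[R]_d) : \bar R :=
  (\int[P]_w \int[lebesgue_measure]_(t in `[0%R, +oo[) (\1_A (X t w))%:E)%E.

(* [f] is a density of the absolutely continuous part of [m]; the null set [N]
   carries the singular part. *)
Definition ac_density (m : set 'rV[R]_d -> \bar R) (f : 'rV[R]_d -> R) : Prop :=
  exists N, [/\ measurable N, lebesgue_rV R d N = 0%E &
    forall A, measurable A ->
      m (A `\` N) = (\int[lebesgue_rV R d]_(x in A) (f x)%:E)%E].

Definition radially_nonincreasing (f : 'rV[R]_d -> R) : Prop :=
  exists2 f0 : R -> R, unimodal_profile f0 &
    forall x, x != 0 -> f x = f0 (eucl_norm x).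

(* The value of [G] at [0] is irrelevant. *)
Definition potential_kernel (X : R -> Omega -> 'rV[R]_d) (G : 'rV[R]_d -> R) :
    Prop :=
  radially_nonincreasing G /\ ac_density (potential_measure X) G.

End levy.

Section exponent.
Context (R : realType) (d : nat).

(* [psi] is continuous, so this real supremum is over a bounded set. *)
Definition psi_star (psi : 'rV[R]_d -> R) (u : R) : R :=
  sup [set psi x | x in [set x | eucl_norm x <= u]].

Definition WLSC (beta theta C : R) (f : 'rV[R]_d -> R) : Prop :=
  (forall x, x != 0 -> 0 < f x) /\
  (forall (lambda : R) x, 1 <= lambda -> x != 0 -> theta <= eucl_norm x ->
    C * lambda `^ beta * f x <= f (lambda *: x)).

End exponent.

(* Main.v *)
Require Import Defs.
From mathcomp Require Import all_boot all_order all_algebra.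
From mathcomp Require Import fingroup perm.
From mathcomp Require Import ring lra.
From mathcomp Require Import all_classical all_reals all_analysis.
From mathcomp Require Import measurable_realfun.
Import Order.TTheory GRing.Theory Num.Theory.
Import numFieldNormedType.Exports.

Set Implicit Arguments.
Unset Strict Implicit.
Unset Printing Implicit Defensive.

Local Open Scope classical_set_scope.
Local Open Scope ring_scope.

(** Both bounds follow from the fact that the potential of the ball of radius [r]
    is comparable to [1 / psi_star (1 / r)], with constants depending on the
    dimension only ([potential_ball_le], [potential_ball_ge]). The kernel being
    radially non-increasing, [G x] is at most the average of the kernel over a
    subset of the ball of radius [|x|], which gives the upper bound
    ([kernel_upper_bound]), and at least its average over a shell of radii [|x|]
    and [|x| / b] ([kernel_lower_bound]). Under the scaling condition [psi_star]
    decreases by a large factor from the frequency [1 / |x|] to the frequency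
    [b / |x|] as soon as [b ^ beta] is a small multiple of [Cstar]; then the ball
    of radius [|x|] has at most half of the potential of the ball of radius
    [|x| / b], and the shell carries the other half.

    The link between the process and its exponent is the identity
    [E (1 - cos <xi, X t>) = 1 - exp (- t psi xi)]. For an isotropic unimodal law
    the left-hand side is comparable to the truncated second moment
    [E (min 1 (|xi| |X t|)^2)]. One direction is elementary
    ([phase_le_norm_cut]). In the other one ([norm_cut_le_phase_integral]) the
    symmetries of the law reduce the question to
    [E (sin (a x_i))^2], which unimodality bounds from below: a quarter-period
    shift towards the origin exchanges [sin] and [cos] and moves to points where
    the density is larger. Only permutations and reflections of the coordinates
    and translations are used, and Lebesgue measure is preserved by them because
    it is determined by the measure of boxes. Letting [t] tend to 0, the exponents
    at two frequencies compare like a quadratic function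
    ([exponent_comparison]), and Markov's inequality bounds the probability to
    leave a ball ([tail_probability_le]), hence the lower bound on the potential
    of balls.

    For the upper bound on the potential of balls, the function
    [x |-> E cos <U - V, x>], with [U] and [V] independent and uniform in a cube
    of size of order [1 / r], is nonnegative and bounded below on the ball of
    radius [r]; therefore [P (|X t| <= r)] is at most a constant times the average
    of [exp (- t psi (U - V))] ([small_ball_fourier]). The quadratic lower bound
    on [psi] makes the latter decay like a power of [t] smaller than -1 in
    dimension at least 3 ([small_ball_decay]), and one integrates in [t].
    Writing the potential as an integral over time of the laws requires Tonelli's
    theorem and the joint measurability of the process, which comes from the
    right-continuity of its paths ([potential_measureE]). *)

(** * Invariance of Lebesgue measure *)

Section lebesgue_rV_invariance.
Context {R : realType}.

Definition box {n} (A : 'I_n -> set (measurableTypeR R)) : set 'rV[R]_n :=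
  [set x | forall i, A i (rV_coord i x)].

Lemma measurable_box n (A : 'I_n -> set (measurableTypeR R)) :
  (forall i, measurable (A i)) -> measurable (box A).
Proof.
move=> mA.
rewrite (_ : box A = \bigcap_(i : 'I_n) (rV_coord i @^-1` A i)); last first.
  by apply/seteqP; split=> [x Ax i _|x Ax i]; exact: Ax.
apply: fin_bigcap_measurable => [|i _]; first exact: finite_finset.
by rewrite -[X in measurable X]setTI; apply: measurable_rV_coord.
Qed.

Lemma lebesgue_rV_boxE n (A : 'I_n -> set (measurableTypeR R)) :
  (forall i, measurable (A i)) ->
  lebesgue_rV R n (box A) = (\prod_(i < n) lebesgue_measure (A i))%E.
Proof. exact: lebesgue_rV_box. Qed.

Lemma measurable_rV_boxes n :
  @measurable _ 'rV[R]_n =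
  <<s [set B | exists2 A : 'I_n -> set (measurableTypeR R),
         (forall i, measurable (A i)) & B = box A] >>.
Proof.
apply/seteqP; split; last first.
  apply: smallest_sub; first exact: sigma_algebra_measurable.
  by move=> _ [A mA ->]; exact: measurable_box.
apply: smallest_sub; first exact: smallest_sigma_algebra.
rewrite -bigcup_seq => _ [i _ [B mB <-]].
apply: sub_sigma_algebra.
exists (fun j => if j == i then B else setT).
  by move=> j; case: ifP.
apply/seteqP; split=> [x [_ /= Bx] j|x /(_ i)].
  by case: eqP => // ->.
by rewrite eqxx.
Qed.

(** Boxes are stable under intersection and generate the Borel sets. *)
Lemma lebesgue_rV_unique n (m : {measure set 'rV[R]_n -> \bar R}) :
  (forall A : 'I_n -> set (measurableTypeR R), (forall i, measurable (A i)) ->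
    m (box A) = (\prod_(i < n) lebesgue_measure (A i))%E) ->
  forall A, measurable A -> m A = lebesgue_rV R n A.
Proof.
move=> mbox.
apply: (measure_unique _ (fun k => box (fun _ => `[(- k%:R)%R, k%:R%R]%classic))
   (measurable_rV_boxes n)).
- move=> _ _ [A mA ->] [B mB ->]; exists (fun i => A i `&` B i).
    by move=> i; exact: measurableI.
  by apply/seteqP; split=> [x [Ax Bx] i|x AB]; split=> // i; case: (AB i).
- by move=> k; exists (fun _ => `[(- k%:R)%R, k%:R%R]%classic).
- apply/seteqP; split=> // x _.
  exists (\max_(i < n) (Num.truncn `|x ord0 i|).+1)%N => // i /=.
  rewrite in_itv/= -ler_norml (le_trans (ltW (truncnS_gt _)))// ler_nat.
  exact: (leq_bigmax i).
- by move=> _ [A mA ->]; rewrite mbox//; exact/esym/lebesgue_rV_boxE.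
- move=> k; rewrite mbox// ltey_eq; apply/orP; left.
  elim/big_ind : _ => // [x y|i _]; first exact: fin_numM.
  by rewrite lebesgue_measure_itv/=; case: ifP.
Qed.

(** Every translation, coordinate reflection and coordinate permutation has
    this form. *)
Definition coordmap {n} (s : {perm 'I_n}) (f : 'I_n -> R -> R) (x : 'rV[R]_n) :
  'rV[R]_n := \row_i f i (x ord0 (s i)).

Lemma measurable_coordmap n (s : {perm 'I_n}) (f : 'I_n -> R -> R) :
  (forall i, measurable_fun setT (f i)) -> measurable_fun setT (coordmap s f).
Proof.
move=> mf; apply/measurable_fun_rVP => i.
rewrite (_ : _ \o _ = f i \o rV_coord (s i)).
  exact: measurableT_comp (mf i) (measurable_rV_coord _).
by apply/funext => x; rewrite /= /rV_coord mxE.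
Qed.

Lemma lebesgue_rV_coordmap n (s : {perm 'I_n}) (f : 'I_n -> R -> R) :
  (forall i, measurable_fun setT (f i)) ->
  (forall i (A : set (measurableTypeR R)), measurable A ->
     lebesgue_measure (f i @^-1` A) = lebesgue_measure A) ->
  forall A, measurable A ->
    lebesgue_rV R n (coordmap s f @^-1` A) = lebesgue_rV R n A.
Proof.
move=> mf lf A mA.
have mc := measurable_coordmap s mf.
apply: (lebesgue_rV_unique (m := pushforward (lebesgue_rV R n) (coordmap s f))) => //.
move=> B mB.
pose C j := f (s^-1%g j) @^-1` B (s^-1%g j).
have mC i : measurable (C i : set (measurableTypeR R)).
  by have := mf (s^-1%g i) measurableT (B (s^-1%g i)) (mB _); rewrite setTI.
transitivity (lebesgue_rV R n (box C)).
  congr (lebesgue_rV R n _); apply/seteqP; split=> x /= Bx i.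
    by have := Bx (s^-1%g i); rewrite /rV_coord mxE permKV.
  by have := Bx (s i); rewrite /rV_coord mxE /C permK.
rewrite lebesgue_rV_boxE// (reindex_inj (@perm_inj _ s))/=.
by apply: eq_bigr => i _; rewrite /C permK lf.
Qed.

Lemma lebesgue_measure_addr (a : R) (A : set (measurableTypeR R)) :
  measurable A -> lebesgue_measure ((fun x => x + a) @^-1` A) = lebesgue_measure A.
Proof.
move=> mA.
have ma : measurable_fun setT (fun x : measurableTypeR R => x + a : measurableTypeR R).
  exact: measurable_realfun.measurable_funD.
apply/esym/(@lebesgue_measure_unique _ (pushforward lebesgue_measure _)) => //.
move=> X [[u v] /= uv <-]; rewrite /pushforward.
have -> : (fun x => x + a) @^-1` `]u, v]%classic = `](u - a), (v - a)]%classic.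
  by apply/seteqP; split=> x /=; rewrite !in_itv/= ltrBlDr lerBrDr.
rewrite !lebesgue_measure_itv/= !lte_fin ltrD2r; case: ifP => // _.
by rewrite -EFinD; congr _%:E; ring.
Qed.

End lebesgue_rV_invariance.

(** * Elementary inequalities *)

Section trigonometry.
Context {R : realType}.
Implicit Types x y : R.

Lemma sin_meanvalue x : 0 < x -> exists2 c, 0 < c < x & sin x = cos c * x.
Proof.
move=> x0; have [|c] := @MVT R sin cos 0 x x0 (fun y _ => is_derive_sin y).
  exact/continuous_subspaceT/continuous_sin.
by rewrite in_itv/= sin0 !subr0 => cx ->; exists c.
Qed.

Lemma sin_sqr_le x : sin x ^+ 2 <= x ^+ 2.
Proof.
wlog x0 : x / 0 < x => [hwlog|].
  have [x0|x0|x0] := ltgtP 0 x; first exact: hwlog.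
    by rewrite -sqrrN -sinN -(sqrrN x) hwlog// oppr_gt0.
  by rewrite -x0 sin0.
have [c _ ->] := sin_meanvalue x0.
by rewrite exprMn ler_piMl ?sqr_ge0// cos2sin2 lerBlDr lerDl sqr_ge0.
Qed.

Lemma one_sub_cos_ge0 x : 0 <= 1 - cos x.
Proof. by rewrite subr_ge0 cos_le1. Qed.

Lemma one_sub_cos_half x : 1 - cos x = 2 * sin (x / 2) ^+ 2.
Proof.
rewrite {1}(_ : x = (x / 2) *+ 2); last by rewrite -mulr_natr; field.
by rewrite cos_mulr2n -mulr_natr cos2sin2; ring.
Qed.

Lemma one_sub_cos_le x : 1 - cos x <= x ^+ 2 / 2.
Proof. by rewrite one_sub_cos_half; have := sin_sqr_le (x / 2); nra. Qed.

Lemma sin_sqr_ge x : `|x| <= 1 -> x ^+ 2 <= 4 * sin x ^+ 2.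
Proof.
wlog x0 : x / 0 < x => [hwlog|].
  have [x0|x0|x0] := ltgtP 0 x; first exact: hwlog.
    by rewrite -normrN -(sqrrN x) -(sqrrN (sin x)) -sinN => /hwlog; apply; rewrite oppr_gt0.
  by rewrite -x0 expr0n/= mulr_ge0// sqr_ge0.
have [c /andP[c0 cx] ->] := sin_meanvalue x0.
rewrite gtr0_norm// => x1; rewrite exprMn.
have := one_sub_cos_le c => hc.
have : 1 / 2 <= cos c by nra.
by move=> h; have : 1 / 4 <= cos c ^+ 2 by [nra]; have := sqr_ge0 x; nra.
Qed.

(** Averaging over a reflection of one coordinate decouples that coordinate:
    [a] stands for its contribution to the phase, [b] for the rest. *)
Lemma reflection_phase (a b : R) :
  sin a ^+ 2 <= (1 - cos (b + a)) + (1 - cos (b - a)).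
Proof.
rewrite cosD cosB sin2cos2.
have := sqr_ge0 (cos a - cos b); have := sqr_ge0 (sin b); rewrite sin2cos2.
by nra.
Qed.

End trigonometry.

Section euclidean_norm.
Context {R : realType} {d : nat}.
Implicit Types x y : 'rV[R]_d.

Lemma inner_ge0 x : 0 <= inner x x.
Proof. by apply: sumr_ge0 => i _; rewrite -expr2 sqr_ge0. Qed.

Lemma eucl_norm_ge0 x : 0 <= eucl_norm x.
Proof. exact: sqrtr_ge0. Qed.

Lemma eucl_norm_sqr x : eucl_norm x ^+ 2 = \sum_(i < d) x ord0 i ^+ 2.
Proof.
by rewrite sqr_sqrtr ?inner_ge0//; apply: eq_bigr => i _; rewrite expr2.
Qed.

Lemma coord_le_eucl_norm x i : `|x ord0 i| <= eucl_norm x.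
Proof.
rewrite -ler_sqr ?nnegrE ?eucl_norm_ge0// eucl_norm_sqr real_normK ?num_real//.
by rewrite (bigD1 i)//= lerDl sumr_ge0// => j _; rewrite sqr_ge0.
Qed.

Lemma eucl_norm_le_coord x (a : R) : 0 <= a ->
  (forall i, `|x ord0 i| <= a) -> eucl_norm x <= d%:R * a.
Proof.
move=> a0 xa; rewrite -ler_sqr ?nnegrE ?eucl_norm_ge0 ?mulr_ge0//.
rewrite eucl_norm_sqr.
apply: (@le_trans _ _ (\sum_(i < d) a ^+ 2)).
  apply: ler_sum => i _; rewrite -[x ord0 i ^+ 2]real_normK ?num_real//.
  by rewrite ler_sqr ?nnegrE.
rewrite sumr_const card_ord exprMn -[leLHS]mulr_natl.
by apply: ler_wpM2r; rewrite ?sqr_ge0// -natrX ler_nat; case: (d) => // n; rewrite leq_pmulr.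
Qed.

Lemma eucl_norm_gt0 x : (0 < eucl_norm x) = (x != 0).
Proof.
rewrite lt_neqAle eucl_norm_ge0 andbT eq_sym; congr (~~ _).
apply/eqP/eqP => [x0|->].
  apply/rowP => i; rewrite mxE; apply/eqP.
  by rewrite -normr_le0 -x0 coord_le_eucl_norm.
by rewrite /eucl_norm /inner big1 ?sqrtr0// => i _; rewrite mxE mulr0.
Qed.

Lemma eucl_norm0 : eucl_norm (0 : 'rV[R]_d) = 0.
Proof.
apply/eqP; rewrite eq_le eucl_norm_ge0 andbT leNgt.
by rewrite eucl_norm_gt0 eqxx.
Qed.

Lemma eucl_normZ (c : R) x : eucl_norm (c *: x) = `|c| * eucl_norm x.
Proof.
apply: (@pexpIrn _ 2) => //; rewrite ?nnegrE ?mulr_ge0 ?eucl_norm_ge0//.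
rewrite exprMn !eucl_norm_sqr real_normK ?num_real// mulr_sumr.
by apply: eq_bigr => i _; rewrite mxE exprMn.
Qed.

Lemma exists_eucl_norm (u : R) : (0 < d)%N -> 0 <= u ->
  exists x : 'rV[R]_d, eucl_norm x = u.
Proof.
move=> d0 u0; pose i0 := Ordinal d0; exists (u *: delta_mx ord0 i0).
rewrite eucl_normZ ger0_norm//.
suff -> : eucl_norm (delta_mx ord0 i0 : 'rV[R]_d) = 1 by rewrite mulr1.
apply: (@pexpIrn _ 2) => //; rewrite ?nnegrE ?eucl_norm_ge0//.
rewrite eucl_norm_sqr (bigD1 i0)//= big1 ?addr0; first by rewrite mxE !eqxx.
by move=> j ji; rewrite mxE (negPf ji) andbF expr0n.
Qed.

Lemma inner_sqr_le x y :
  inner x y ^+ 2 <= (d%:R * (eucl_norm x * eucl_norm y)) ^+ 2.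
Proof.
rewrite -[inner x y ^+ 2]real_normK ?num_real//.
rewrite ler_sqr ?nnegrE ?mulr_ge0 ?eucl_norm_ge0//.
apply: (le_trans (ler_norm_sum _ _ _)).
apply: (@le_trans _ _ (\sum_(i < d) eucl_norm x * eucl_norm y)).
  by apply: ler_sum => i _; rewrite normrM ler_pM// coord_le_eucl_norm.
by rewrite sumr_const card_ord mulr_natl.
Qed.

(** A coordinate of largest modulus. *)
Lemma exists_large_coord x : (0 < d)%N ->
  exists i, eucl_norm x ^+ 2 <= d%:R * x ord0 i ^+ 2.
Proof.
move=> d0; pose F i := x ord0 i ^+ 2.
exists [arg max_(i > Ordinal d0) F i]%O; case: arg_maxP => //= i _ Fi.
rewrite eucl_norm_sqr (le_trans (ler_sum _ (fun j _ => Fi j _)))//.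
by rewrite sumr_const card_ord mulr_natl.
Qed.

Lemma measurable_coord i : measurable_fun setT (fun x : 'rV[R]_d => x ord0 i).
Proof. exact: measurable_rV_coord. Qed.

Lemma measurable_eucl_norm : measurable_fun setT (@eucl_norm R d).
Proof.
apply: (measurableT_comp (continuous_measurable_fun (@sqrt_continuous R))).
by apply: measurable_sum => i; apply: measurable_funM; exact: measurable_coord.
Qed.

Lemma measurable_inner (x : 'rV[R]_d) : measurable_fun setT (inner x).
Proof.
by apply: measurable_sum => i; apply: measurable_funM => //; exact: measurable_coord.
Qed.

End euclidean_norm.

(** * Isotropic unimodal laws *)

Section isotropic_unimodal_law.
Context {R : realType} {d : nat}.
Implicit Types (x : 'rV[R]_d) (i : 'I_d).

(** The superlevel sets of a monotone function are intervals. *)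
Lemma measurable_profile (m0 : R -> R) (A : set 'rV[R]_d) :
  unimodal_profile m0 -> measurable A -> ~ A 0 ->
  measurable_fun A (fun x => m0 (eucl_norm x)).
Proof.
move=> [m00 m0mono] mA A0.
have mpos : measurable_fun (`]0%R, +oo[%classic : set R) m0.
  move=> mD; apply: (measurability _ (RGenOInfty.measurableE R)) => //.
  move=> _ [_ [c ->] <-]; apply: is_interval_measurable => x y /=.
  rewrite !in_itv/= !andbT => -[x0 cx] [y0 cy] z /andP[xz zy].
  have z0 := lt_le_trans x0 xz.
  by rewrite in_itv/= andbT; split => //; rewrite in_itv/= andbT (lt_le_trans cy)// m0mono.
apply: (@measurable_comp _ _ _ _ _ _ (`]0%R, +oo[%classic : set R)) => //.
  move=> _ [x Ax <-]; rewrite /= in_itv/= andbT eucl_norm_gt0.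
  by apply: contra_notN A0 => /eqP <-.
exact: measurable_funS measurable_eucl_norm.
Qed.

Section law.
Variable mu : {measure set 'rV[R]_d -> \bar R}.
Hypothesis iu : isotropic_unimodal mu.

(** The change of variable [T] turns the left-hand side into the integral over
    the preimage of the density at [T x], which is at most the density at [x]. *)
Lemma isotropic_unimodal_contract (T : 'rV[R]_d -> 'rV[R]_d) (A : set 'rV[R]_d) :
  measurable_fun setT T ->
  (forall B, measurable B -> lebesgue_rV R d (T @^-1` B) = lebesgue_rV R d B) ->
  measurable A -> ~ A 0 -> ~ A (T 0) ->
  (forall x, A (T x) -> eucl_norm x <= eucl_norm (T x)) ->
  (mu A <= mu (T @^-1` A))%E.
Proof.
move=> mT leT mA A0 AT0 Tx; have [m0 um0 muE] := iu.
have mTA : measurable (T @^-1` A).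
  by rewrite -[X in measurable X]setTI; exact: mT.
have mm0 := fun A mA => measurable_profile um0 (A := A) mA.
have nneg B x : ~ B 0 -> B x -> 0 <= m0 (eucl_norm x).
  move=> B0 Bx; apply: (um0).1; rewrite eucl_norm_gt0.
  by apply: contra_notN B0 => /eqP <-.
rewrite !muE//.
have -> : (\int[lebesgue_rV R d]_(x in A) (m0 (eucl_norm x))%:E =
    \int[pushforward (lebesgue_rV R d) T]_(x in A) (m0 (eucl_norm x))%:E)%E.
  by apply: eq_measure_integral => B mB _; exact/esym/leT.
rewrite ge0_integral_pushforward//; last 2 first.
- by apply/measurable_EFinP; exact: mm0.
- by move=> y /set_mem Ay; rewrite lee_fin; exact: nneg Ay.
apply: ge0_le_integral => //=.
- by move=> x Ax; rewrite lee_fin; exact: nneg Ax.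
- apply/measurable_EFinP; apply: (@measurable_comp _ _ _ _ _ _ A (fun y => m0 (eucl_norm y)) _ T) => //.
  + by move=> _ [x Ax <-].
  + exact: mm0.
  + exact: measurable_funS mT.
- by apply/measurable_EFinP; exact: mm0.
- move=> x Ax; rewrite lee_fin; apply: (um0).2; last exact: Tx.
  rewrite eucl_norm_gt0.
  by apply: contra_notN AT0 => /eqP <-.
Qed.

(** The previous lemma applied to [T] in both directions; the origin, where the
    law may have an atom, is fixed by [T] and treated apart. *)
Lemma isotropic_unimodal_involution (T : 'rV[R]_d -> 'rV[R]_d) (A : set 'rV[R]_d) :
  measurable_fun setT T ->
  (forall B, measurable B -> lebesgue_rV R d (T @^-1` B) = lebesgue_rV R d B) ->
  (forall x, eucl_norm (T x) = eucl_norm x) -> involutive T ->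
  measurable A -> mu (T @^-1` A) = mu A.
Proof.
move=> mT leT nT TK.
have T0 : T 0 = 0.
  by apply/eqP; rewrite -[_ == _]negbK -eucl_norm_gt0 nT eucl_norm0 ltxx.
have mTA (B : set 'rV[R]_d) : measurable B -> measurable (T @^-1` B).
  by move=> mB; rewrite -[X in measurable X]setTI; exact: mT.
have le (B : set 'rV[R]_d) : measurable B -> ~ B 0 -> (mu B <= mu (T @^-1` B))%E.
  move=> mB B0; apply: isotropic_unimodal_contract => //; first by rewrite T0.
  by move=> x _; rewrite nT.
have main (B : set 'rV[R]_d) : measurable B -> ~ B 0 -> mu (T @^-1` B) = mu B.
  move=> mB B0; apply/eqP; rewrite eq_le le// andbT.
  apply: le_trans (le _ (mTA _ mB) _) _; first by rewrite /= T0.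
  rewrite -comp_preimage (_ : T \o T = id) ?preimage_id//.
  by apply/funext => x /=; rewrite TK.
move=> mA.
have m1 : measurable [set (0 : 'rV[R]_d)].
  rewrite (_ : [set _] = box (fun _ => [set 0])).
    by apply: measurable_box => i; exact: measurable_set1.
  apply/seteqP; split=> [_ -> i|x x0]; first by rewrite /rV_coord /= mxE.
  by apply/rowP => i; rewrite mxE; exact: x0.
rewrite (measureDI mu mA m1) (measureDI mu (mTA _ mA) m1); congr (_ + _)%E.
  rewrite (_ : _ `\` _ = T @^-1` (A `\` [set 0])).
    by apply: main; [exact: measurableD|case=> _ /(_ erefl)].
  apply/seteqP; split=> x /= [Ax x0]; split=> //.
    by rewrite -T0 => /(inv_inj TK).
  by move=> xE; apply: x0; rewrite xE T0.
congr (mu _); apply/seteqP; split=> x /= [Ax xE]; split=> //;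
  by move: Ax; rewrite xE T0.
Qed.

Lemma integral_involution (T : 'rV[R]_d -> 'rV[R]_d) (f : 'rV[R]_d -> \bar R) :
  measurable_fun setT T ->
  (forall B, measurable B -> lebesgue_rV R d (T @^-1` B) = lebesgue_rV R d B) ->
  (forall x, eucl_norm (T x) = eucl_norm x) -> involutive T ->
  measurable_fun setT f -> (forall x, 0 <= f x)%E ->
  (\int[mu]_x f (T x) = \int[mu]_x f x)%E.
Proof.
move=> mT leT nT TK mf f0.
have -> : (\int[mu]_x f x = \int[pushforward mu T]_x f x)%E.
  apply: eq_measure_integral => B mB _.
  by apply/esym; exact: isotropic_unimodal_involution.
by rewrite [RHS](ge0_integral_pushforward mT).
Qed.

Definition flip i (j : 'I_d) (y : R) : R := if j == i then - y else y.

Lemma integral_flip i (f : 'rV[R]_d -> \bar R) :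
  measurable_fun setT f -> (forall x, 0 <= f x)%E ->
  (\int[mu]_x f (coordmap 1 (flip i) x) = \int[mu]_x f x)%E.
Proof.
have mflip j : measurable_fun setT (flip i j).
  by rewrite /flip; case: eqP => // _; exact: measurable_funN.
apply: integral_involution.
- exact: measurable_coordmap.
- apply: lebesgue_rV_coordmap => // j A mA; rewrite /flip; case: eqP => // _.
  exact: lebesgue_measureN.
- move=> x; congr Num.sqrt; apply: eq_bigr => j _.
  by rewrite !mxE perm1 /flip; case: eqP => // _; rewrite mulrNN.
- move=> x; apply/rowP => j; rewrite !mxE !perm1 /flip.
  by case: eqP => // _; rewrite opprK.
Qed.

Lemma integral_swap i j (f : 'rV[R]_d -> \bar R) :
  measurable_fun setT f -> (forall x, 0 <= f x)%E ->
  (\int[mu]_x f (coordmap (tperm i j) (fun _ => id) x) = \int[mu]_x f x)%E.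
Proof.
apply: integral_involution.
- by apply: measurable_coordmap => k; exact: measurable_id.
- by apply: lebesgue_rV_coordmap.
- move=> x; congr Num.sqrt; rewrite [RHS](reindex_inj (@perm_inj _ (tperm i j))).
  by apply: eq_bigr => k _; rewrite !mxE.
- by move=> x; apply/rowP => k; rewrite !mxE tpermK.
Qed.

End law.
End isotropic_unimodal_law.

(** * Phase integrals and truncated second moments *)

Section measurability.
Context {R : realType} {disp} {T : measurableType disp}.

Lemma measurable_sin_comp (f : T -> R) :
  measurable_fun setT f -> measurable_fun setT (fun x => sin (f x)).
Proof.
by move=> mf; apply: (measurableT_comp (continuous_measurable_fun (@continuous_sin R))).
Qed.

Lemma measurable_cos_comp (f : T -> R) :
  measurable_fun setT f -> measurable_fun setT (fun x => cos (f x)).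
Proof.
by move=> mf; apply: (measurableT_comp (continuous_measurable_fun (@continuous_cos R))).
Qed.

Lemma measurable_one_sub_cos (f : T -> R) :
  measurable_fun setT f -> measurable_fun setT (fun x => 1 - cos (f x)).
Proof. by move=> mf; apply: measurable_funB => //; exact: measurable_cos_comp. Qed.

Lemma measurable_le_set (f g : T -> R) : measurable_fun setT f ->
  measurable_fun setT g -> measurable [set x | f x <= g x].
Proof.
move=> mf mg; have := measurable_fun_ler mf mg measurableT (_ : measurable [set true]).
by rewrite setTI; apply.
Qed.

End measurability.

Section phase_integral.
Context {R : realType} {d : nat}.
Implicit Types (x xi : 'rV[R]_d) (i : 'I_d).
Variable mu : {measure set 'rV[R]_d -> \bar R}.
Hypothesis iu : isotropic_unimodal mu.

Let msin a i : measurable_fun setT (fun x : 'rV[R]_d => (sin (a * x ord0 i) ^+ 2)).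
Proof.
apply: measurable_funX; apply: measurable_sin_comp; apply: measurable_funM => //.
exact: measurable_coord.
Qed.

Let mphase xi : measurable_fun setT (fun x => 1 - cos (inner xi x)).
Proof. by apply: measurable_one_sub_cos; exact: measurable_inner. Qed.

Lemma sin_sqr_integral_le_phase xi i :
  (\int[mu]_x (sin (xi ord0 i * x ord0 i) ^+ 2)%:E <=
   2%:E * \int[mu]_x (1 - cos (inner xi x))%:E)%E.
Proof.
pose T := coordmap 1 (@flip R d i).
have F0 x : (0 <= (1 - cos (inner xi x))%:E)%E by rewrite lee_fin one_sub_cos_ge0.
have mF : measurable_fun setT (fun x => (1 - cos (inner xi x))%:E).
  exact/measurable_EFinP.
have mT : measurable_fun setT T.
  apply: measurable_coordmap => j; rewrite /flip.
  by case: eqP => // _; exact: measurable_funN.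
have mFT : measurable_fun setT (fun x => (1 - cos (inner xi (T x)))%:E).
  by apply/measurable_EFinP; apply: (measurableT_comp (mphase xi) mT).
rewrite mule_natl mule2n -{2}(integral_flip iu i mF F0).
rewrite -ge0_integralD//.
apply: ge0_le_integral => //=.
- by move=> x _; rewrite lee_fin sqr_ge0.
- exact/measurable_EFinP.
- by apply: emeasurable_funD.
- move=> x _; rewrite -EFinD lee_fin.
  rewrite (le_trans (reflection_phase _ (inner xi x - xi ord0 i * x ord0 i)))//.
  rewrite subrK lerD2l (_ : inner xi (T x) =
    inner xi x - xi ord0 i * x ord0 i - xi ord0 i * x ord0 i)//.
  rewrite /inner (bigD1 i)//= [in RHS](bigD1 i)//= /T !mxE perm1 /flip eqxx.
  rewrite (eq_bigr (fun j => xi ord0 j * x ord0 j)); first by ring.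
  by move=> j ji; rewrite !mxE perm1 (negPf ji).
Qed.

(** On this half-space the shift by [v] along the [i]-th coordinate does not
    increase the norm, so the law gives at least as much mass to a shifted set.
    A quarter-period shift exchanges [sin] and [cos], hence [sin ^+ 2] is at
    least 1/2 at [x] or at its translate. *)
Lemma halfspace_le_sin_sqr_integral (a v : R) i : v != 0 ->
  (forall y, sin (a * (y + v)) ^+ 2 = cos (a * y) ^+ 2) ->
  (mu [set x : 'rV[R]_d | x ord0 i * v <= - (v ^+ 2 / 2)]%R <=
   4%:E * \int[mu]_x (sin (a * x ord0 i) ^+ 2)%:E)%E.
Proof.
move=> v0 sinav.
set H := [set x | _].
pose S := [set x : 'rV[R]_d | 1 / 2 <= sin (a * x ord0 i) ^+ 2].
have mS : measurable S.
  by apply: measurable_le_set; [exact: measurable_cst|exact: msin].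
have mH : measurable H.
  apply: measurable_le_set => //.
  by apply: measurable_funM => //; exact: measurable_coord.
have v2 : 0 < v ^+ 2 by rewrite exprn_even_gt0.
pose f (j : 'I_d) (y : R) := if j == i then y - v else y.
pose T := coordmap 1 f.
have mf j : measurable_fun setT (f j).
  by rewrite /f; case: eqP => // _; exact: measurable_funB.
have mT : measurable_fun setT T by exact: measurable_coordmap.
have leT B : measurable B -> lebesgue_rV R d (T @^-1` B) = lebesgue_rV R d B.
  apply: lebesgue_rV_coordmap => // j A mA; rewrite /f; case: eqP => // _.
  exact: lebesgue_measure_addr.
have Ti x : T x ord0 i = x ord0 i - v by rewrite mxE perm1 /f eqxx.
have mHS : measurable (H `\` S) by exact: measurableD.
have TS : T @^-1` (H `\` S) `<=` S.
  move=> x [_]; rewrite /S [_ (T x)]/= Ti => /negP; rewrite -ltNge /=.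
  have := sinav (x ord0 i - v); rewrite subrK => ->.
  by rewrite cos2sin2; lra.
have le1 : (mu (H `\` S) <= mu S)%E.
  apply: (@le_trans _ _ (mu (T @^-1` (H `\` S)))); last first.
    apply: le_measure => //; rewrite inE//.
    by rewrite -[X in measurable X]setTI; exact: mT.
  apply: isotropic_unimodal_contract => //.
  - by move=> []; rewrite /H/= mxE mul0r; lra.
  - move=> /TS; rewrite /S /= mxE mulr0 sin0 expr0n/=; lra.
  - move=> x []; rewrite /H [_ (T x)]/= Ti => xH _.
    rewrite -ler_sqr ?nnegrE ?eucl_norm_ge0// !eucl_norm_sqr.
    rewrite (bigD1 i)//= [leRHS](bigD1 i)//= Ti.
    apply: lerD; first by nra.
    by apply: ler_sum => j ji; rewrite mxE perm1 /f (negPf ji).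
have leS : (mu S <= 2%:E * \int[mu]_x (sin (a * x ord0 i) ^+ 2)%:E)%E.
  rewrite -[S]setIT -integral_indic// -ge0_integralZl//; last 2 first.
  - exact/measurable_EFinP.
  - by move=> x _; rewrite lee_fin sqr_ge0.
  apply: ge0_le_integral => //.
  - by apply/measurable_EFinP; apply: measurable_indic.
  - by apply/measurable_EFinP; apply: measurable_funM.
  - move=> x _; rewrite lee_fin indicE; case: (boolP (x \in S)) => /= [/set_mem|_].
      by rewrite /S/=; lra.
    by rewrite mulr_ge0 ?sqr_ge0.
rewrite (@le_trans _ _ (mu S + mu S)%E)//.
  rewrite (measureDI mu mH mS) leeD//.
  by apply: le_measure; rewrite ?inE//; exact: measurableI.
rewrite -mule2n -mule_natl (_ : 4%:E = 2%:E * 2%:E :> \bar R)%E.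
  by rewrite -muleA lee_pmul2l// lte_fin.
by rewrite -EFinM; congr _%:E; ring.
Qed.

Let halfspace_cases (p a v y : R) : 0 < p -> a * v = p / 2 -> v != 0 ->
  p / 4 <= `|a * y| ->
  y * v <= - (v ^+ 2 / 2) \/ y * - v <= - ((- v) ^+ 2 / 2).
Proof.
move=> p0 av v0.
have E : p / 2 * (y * v) = v ^+ 2 * (a * y) by rewrite -av; ring.
have v2 : 0 < v ^+ 2 by rewrite exprn_even_gt0.
rewrite sqrrN mulrN lerN2.
have [h|h] := lerP 0 (a * y).
  rewrite ger0_norm// => hx; right.
  have : v ^+ 2 * (p / 4) <= v ^+ 2 * (a * y) by rewrite ler_pM2l.
  rewrite -E; nra.
rewrite ltr0_norm// => hx; left.
have : v ^+ 2 * (p / 4) <= v ^+ 2 * (- (a * y)) by rewrite ler_pM2l.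
rewrite mulrN -E; nra.
Qed.

(** The two half-spaces obtained from [v] and [- v] cover the tail. *)
Lemma tail_le_sin_sqr_integral (a : R) i : a != 0 ->
  (mu [set x : 'rV[R]_d | pi / 4 <= `|a * x ord0 i|]%R <=
   8%:E * \int[mu]_x (sin (a * x ord0 i) ^+ 2)%:E)%E.
Proof.
move=> a0; pose v := pi / 2 / a.
have av : a * v = pi / 2 by rewrite /v mulrC divfK.
have v0 : v != 0 by rewrite /v !mulf_neq0 ?invr_neq0// gt_eqF// pi_gt0.
clearbody v.
pose H (w : R) := [set x : 'rV[R]_d | x ord0 i * w <= - (w ^+ 2 / 2)].
have mH w : measurable (H w).
  apply: measurable_le_set => //.
  by apply: measurable_funM => //; exact: measurable_coord.
have h1 : (mu (H v) <= 4%:E * \int[mu]_x (sin (a * x ord0 i) ^+ 2)%:E)%E.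
  apply: halfspace_le_sin_sqr_integral => // y.
  by rewrite mulrDr av sinDpihalf.
have h2 : (mu (H (- v)%R) <= 4%:E * \int[mu]_x (sin (a * x ord0 i) ^+ 2)%:E)%E.
  apply: halfspace_le_sin_sqr_integral; rewrite ?oppr_eq0// => y.
  by rewrite mulrBr av sinBpihalf sqrrN.
have -> : 8%:E = (4%:E + 4%:E)%E :> \bar R by rewrite -EFinD; congr _%:E; ring.
rewrite ge0_muleDl// (le_trans _ (leeD h1 h2))//.
apply: le_trans (measureU2 _ (mH _) (mH _)).
apply: le_measure; rewrite ?inE//.
- apply: measurable_le_set => //.
  apply: measurableT_comp => //; apply: measurable_funM => //.
  exact: measurable_coord.
- exact: measurableU.
- by move=> x /= hx; exact: halfspace_cases (pi_gt0 R) av v0 hx.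
Qed.

Let mcut (u : R) i :
  measurable_fun setT (fun x : 'rV[R]_d => Num.min 1 ((u * x ord0 i) ^+ 2)).
Proof.
apply: measurable_minr => //; apply: measurable_funX; apply: measurable_funM => //.
exact: measurable_coord.
Qed.

Let mcut_norm (u : R) :
  measurable_fun setT (fun x : 'rV[R]_d => Num.min 1 ((u * eucl_norm x) ^+ 2)).
Proof.
apply: measurable_minr => //; apply: measurable_funX; apply: measurable_funM => //.
exact: measurable_eucl_norm.
Qed.

Let cut_ge0 (u : R) : 0 <= Num.min 1 (u ^+ 2).
Proof. by rewrite le_min ler01 sqr_ge0. Qed.

Lemma coord_cut_le_sin_sqr_integral (a : R) i : a != 0 ->
  (\int[mu]_x (Num.min 1 ((a * x ord0 i) ^+ 2))%:E <=
   12%:E * \int[mu]_x (sin (a * x ord0 i) ^+ 2)%:E)%E.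
Proof.
move=> a0; pose L := [set x : 'rV[R]_d | pi / 4 <= `|a * x ord0 i|].
have mL : measurable L.
  apply: measurable_le_set => //; apply: measurableT_comp => //.
  by apply: measurable_funM => //; exact: measurable_coord.
have s0 (x : 'rV[R]_d) : 0 <= sin (a * x ord0 i) ^+ 2 by rewrite sqr_ge0.
apply: (@le_trans _ _ (\int[mu]_x (4 * sin (a * x ord0 i) ^+ 2)%:E +
    \int[mu]_x (\1_L x)%:E)%E).
  rewrite -ge0_integralD//=; last 3 first.
  - by move=> x _; rewrite lee_fin mulr_ge0.
  - by apply/measurable_EFinP; apply: measurable_funM.
  - by apply/measurable_EFinP; apply: measurable_indic.
  apply: ge0_le_integral => //=.
  - by move=> x _; rewrite lee_fin cut_ge0.
  - exact/measurable_EFinP.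
  - apply: emeasurable_funD; apply/measurable_EFinP; first exact: measurable_funM.
    exact: measurable_indic.
  - move=> x _; rewrite -EFinD lee_fin indicE.
    case: (boolP (x \in L)) => /= [_|xL].
      by rewrite (@le_trans _ _ 1)// ?ge_min ?lexx// lerDr mulr_ge0.
    rewrite addr0 (le_trans _ (sin_sqr_ge _))// ?ge_min ?lexx ?orbT//.
    have : ~ L x by apply/negP; move: xL; rewrite notin_setE => /negP.
    rewrite /L/= => /negP; rewrite -ltNge => /ltW/le_trans; apply.
    by have := pihalf_lt2 R; rewrite !ltr_pdivrMr// => ?; rewrite ler_pdivrMr//; lra.
rewrite (_ : 12%:E = (4%:E + 8%:E)%E :> \bar R); last first.
  by rewrite -EFinD; congr _%:E; ring.
rewrite ge0_muleDl//; apply: leeD.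
  rewrite -ge0_integralZl//; first exact/measurable_EFinP.
  by move=> x _; rewrite lee_fin.
rewrite integral_indic// setIT; exact: tail_le_sin_sqr_integral.
Qed.

(** All coordinates have the same distribution. *)
Lemma norm_cut_le_coord_cut_integral (a : R) i :
  (\int[mu]_x (Num.min 1 ((a * eucl_norm x) ^+ 2))%:E <=
   d%:R%:E * \int[mu]_x (Num.min 1 ((a * x ord0 i) ^+ 2))%:E)%E.
Proof.
have mE j : measurable_fun setT
    (fun x : 'rV[R]_d => (Num.min 1 ((a * x ord0 j) ^+ 2))%:E).
  by apply/measurable_EFinP; exact: mcut.
have E0 j (x : 'rV[R]_d) : (0 <= (Num.min 1 ((a * x ord0 j) ^+ 2))%:E)%E.
  by rewrite lee_fin cut_ge0.
have swapE j : (\int[mu]_x (Num.min 1 ((a * x ord0 j) ^+ 2))%:E =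
    \int[mu]_x (Num.min 1 ((a * x ord0 i) ^+ 2))%:E)%E.
  rewrite -(integral_swap iu i j (mE i) (E0 i)).
  by apply: eq_integral => x _; rewrite mxE tpermL.
apply: (@le_trans _ _
    (\int[mu]_x \sum_(j < d) (Num.min 1 ((a * x ord0 j) ^+ 2))%:E)%E).
  apply: ge0_le_integral => //=.
  - by move=> x _; rewrite lee_fin cut_ge0.
  - by apply/measurable_EFinP; exact: mcut_norm.
  - exact: emeasurable_sum.
  - move=> x _; rewrite sumEFin lee_fin.
    have [/existsP[j aj]|/existsPn h] :=
        boolP [exists j : 'I_d, 1 <= (a * x ord0 j) ^+ 2].
      rewrite (@le_trans _ _ 1) ?ge_min ?lexx// (bigD1 j)//=.
      rewrite (min_idPl aj) lerDl sumr_ge0// => k _; exact: cut_ge0.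
    rewrite ge_min; apply/orP; right.
    rewrite exprMn eucl_norm_sqr mulr_sumr; apply: ler_sum => j _.
    by rewrite (min_idPr _) ?exprMn// -exprMn ltW// ltNge; exact: h.
rewrite ge0_integral_sum//=.
rewrite (eq_bigr _ (fun j _ => swapE j)).
by rewrite sumr_const card_ord mule_natl.
Qed.

(** The key estimate. Reflecting the coordinate where [xi] is largest isolates
    that coordinate, unimodality bounds its truncated second moment, and the
    symmetry between coordinates yields the other ones. *)
Lemma norm_cut_le_phase_integral xi : (0 < d)%N ->
  (\int[mu]_x (Num.min 1 ((eucl_norm xi * eucl_norm x) ^+ 2))%:E <=
   (24 * d%:R ^+ 2)%:E * \int[mu]_x (1 - cos (inner xi x))%:E)%E.
Proof.
move=> d0; have F0 z : (0 <= \int[mu]_x (1 - cos (inner z x))%:E)%E.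
  by apply: integral_ge0 => x _; rewrite lee_fin one_sub_cos_ge0.
have [->|xi0] := eqVneq xi 0.
  rewrite integral0_eq ?mule_ge0// ?lee_fin ?mulr_ge0//.
  by move=> x _; rewrite eucl_norm0 mul0r expr0n/= (min_idPr _).
have [i hi] := exists_large_coord xi d0.
have a0 : xi ord0 i != 0.
  apply: contraTneq hi => ->; rewrite expr0n/= mulr0 -ltNge.
  by rewrite exprn_even_gt0//= gt_eqF// eucl_norm_gt0.
have d1 : 1 <= d%:R :> R by rewrite ler1n.
apply: (@le_trans _ _ (d%:R%:E *
    \int[mu]_x (Num.min 1 ((xi ord0 i * eucl_norm x) ^+ 2))%:E)%E).
  rewrite -ge0_integralZl//; last 2 first.
  - by apply/measurable_EFinP; exact: mcut_norm.
  - by move=> x _; rewrite lee_fin cut_ge0.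
  apply: ge0_le_integral => //=.
  - by move=> x _; rewrite lee_fin cut_ge0.
  - by apply/measurable_EFinP; exact: mcut_norm.
  - by apply/measurable_EFinP; apply: measurable_funM => //; exact: mcut_norm.
  - move=> x _; rewrite lee_fin minr_pMr ?ler0n// mulr1 le_min !ge_min.
    rewrite d1/=; apply/orP; right.
    by rewrite !exprMn [leRHS]mulrA; apply: ler_wpM2r => //; exact: sqr_ge0.
have dE : (0 <= d%:R%:E :> \bar R)%E by rewrite lee_fin ler0n.
apply: (le_trans (lee_wpmul2l dE (norm_cut_le_coord_cut_integral _ i))).
rewrite muleA -EFinM.
have d2E : (0 <= (d%:R * d%:R)%:E :> \bar R)%E by rewrite lee_fin mulr_ge0.
apply: (le_trans (lee_wpmul2l d2E (coord_cut_le_sin_sqr_integral i a0))).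
rewrite muleA -EFinM.
have d3E : (0 <= (d%:R * d%:R * 12)%:E :> \bar R)%E by rewrite lee_fin !mulr_ge0.
apply: (le_trans (lee_wpmul2l d3E (sin_sqr_integral_le_phase xi i))).
by rewrite muleA -EFinM le_eqVlt; apply/orP; left; apply/eqP; congr (_%:E * _)%E; ring.
Qed.

Lemma phase_le_norm_cut xi x :
  1 - cos (inner xi x) <=
  2 * d%:R ^+ 2 * Num.min 1 ((eucl_norm xi * eucl_norm x) ^+ 2).
Proof.
have [d0|d0] := posnP d.
  rewrite /inner; move: xi x; rewrite d0 => xi x.
  by rewrite big_ord0 cos0 subrr expr0n/= mulr0 mul0r.
have d1 : 1 <= d%:R :> R by rewrite ler1n.
rewrite minr_pMr ?mulr_ge0// mulr1 le_min; apply/andP; split.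
  by have := cos_geN1 (inner xi x); nra.
apply: (le_trans (one_sub_cos_le _)).
rewrite ler_pdivrMr// (le_trans (inner_sqr_le _ _))//.
have := sqr_ge0 (d%:R * (eucl_norm xi * eucl_norm x)).
by rewrite -[2 * _ * _]mulrA -exprMn; lra.
Qed.

(** Both sides are comparable to truncated second moments, which grow at most
    quadratically with the frequency. *)
Lemma phase_integral_comparison (lambda : R) eta xi : (0 < d)%N -> 1 <= lambda ->
  eucl_norm eta <= lambda * eucl_norm xi ->
  (\int[mu]_x (1 - cos (inner eta x))%:E <=
   (48 * d%:R ^+ 4 * lambda ^+ 2)%:E * \int[mu]_x (1 - cos (inner xi x))%:E)%E.
Proof.
move=> d0 l1 hle.
have l2 : 1 <= lambda ^+ 2 by nra.
apply: (@le_trans _ _ ((2 * d%:R ^+ 2 * lambda ^+ 2)%:E *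
    \int[mu]_x (Num.min 1 ((eucl_norm xi * eucl_norm x) ^+ 2))%:E)%E).
  rewrite -ge0_integralZl//; last 3 first.
  - by apply/measurable_EFinP; exact: mcut_norm.
  - by move=> x _; rewrite lee_fin cut_ge0.
  - by rewrite lee_fin (mulr_ge0 (mulr_ge0 _ (sqr_ge0 _)) (sqr_ge0 _)).
  apply: ge0_le_integral => //=.
  - exact/measurable_EFinP.
  - by apply/measurable_EFinP; apply: measurable_funM => //; exact: mcut_norm.
  - move=> x _; rewrite lee_fin (le_trans (phase_le_norm_cut _ _))//.
    rewrite -[leRHS]mulrA; apply: ler_wpM2l; first by rewrite mulr_ge0 ?sqr_ge0.
    rewrite minr_pMr ?sqr_ge0// mulr1 le_min !ge_min l2/=; apply/orP; right.
    rewrite !exprMn [leRHS]mulrA; apply: ler_wpM2r; first exact: sqr_ge0.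
    rewrite -exprMn ler_sqr ?nnegrE ?mulr_ge0 ?eucl_norm_ge0//.
    exact: le_trans l1.
have c0 : (0 <= (2 * d%:R ^+ 2 * lambda ^+ 2)%:E :> \bar R)%E.
  by rewrite lee_fin (mulr_ge0 (mulr_ge0 _ (sqr_ge0 _)) (sqr_ge0 _)).
apply: (le_trans (lee_wpmul2l c0 (norm_cut_le_phase_integral xi d0))).
by rewrite muleA -EFinM le_eqVlt; apply/orP; left; apply/eqP; congr (_%:E * _)%E; ring.
Qed.

(** Markov's inequality for the truncated second moment. *)
Lemma tail_le_phase_integral (r : R) xi : (0 < d)%N -> 0 < r ->
  eucl_norm xi = r^-1 ->
  (mu [set x : 'rV[R]_d | r < eucl_norm x]%R <=
   (24 * d%:R ^+ 2)%:E * \int[mu]_x (1 - cos (inner xi x))%:E)%E.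
Proof.
move=> d0 r0 xir.
have mT : measurable [set x : 'rV[R]_d | r < eucl_norm x].
  rewrite (_ : [set _ | _] = ~` [set x : 'rV[R]_d | eucl_norm x <= r]).
    by apply/measurableC/measurable_le_set => //; exact: measurable_eucl_norm.
  by apply/seteqP; split=> x /=; [move/lt_geF => ->|move/negP; rewrite ltNge].
apply: le_trans (norm_cut_le_phase_integral xi d0).
rewrite -[X in mu X]setIT -integral_indic//; apply: ge0_le_integral => //=.
- by apply/measurable_EFinP; apply: measurable_indic.
- by apply/measurable_EFinP; exact: mcut_norm.
- move=> x _; rewrite lee_fin indicE; case: (boolP (x \in _)) => //= /set_mem/= rx.
  rewrite (min_idPl _)// expr_ge1// ?mulr_ge0 ?eucl_norm_ge0//.
  by rewrite xir mulrC ler_pdivlMr// mul1r ltW.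
Qed.

End phase_integral.

(** * Positive definiteness of the cosine *)

Section positive_definite.
Context {R : realType} {disp} {T : measurableType disp}.
Variables (m : {measure set T -> \bar R}) (Q : set T).
Hypotheses (mQ : measurable Q) (Qfin : (m Q < +oo)%E).

Lemma bounded_integrable (f : T -> R) (M : R) : measurable_fun setT f ->
  (forall x, `|f x| <= M) -> m.-integrable Q (EFin \o f).
Proof.
move=> mf fM; apply: measurable_bounded_integrable => //.
  exact: measurable_funTS.
by exists M; split; [exact: num_real|move=> N MN x _; exact: le_trans (ltW MN)].
Qed.

Lemma integral_Rintegral (f : T -> R) : m.-integrable Q (EFin \o f) ->
  (\int[m]_(x in Q) (f x)%:E = (\int[m]_(x in Q) f x)%:E)%E.
Proof. by move=> fi; rewrite fineK//; exact: integrable_fin_num fi. Qed.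

Variable p : T -> R.
Hypothesis mp : measurable_fun setT p.

Let C := \int[m]_(v in Q) cos (p v).
Let S := \int[m]_(v in Q) sin (p v).
Let q := fine (m Q).

Let cos_integrable : m.-integrable Q (EFin \o (fun v => cos (p v))).
Proof.
apply: bounded_integrable; first exact: measurable_cos_comp.
by move=> x; exact: cos_max.
Qed.

Let sin_integrable : m.-integrable Q (EFin \o (fun v => sin (p v))).
Proof.
apply: bounded_integrable; first exact: measurable_sin_comp.
by move=> x; exact: sin_max.
Qed.

Let cst_integrable (a : R) : m.-integrable Q (EFin \o (fun _ => a)).
Proof. exact: (@bounded_integrable _ `|a|). Qed.

Let scale_integrable (a : R) (f : T -> R) : m.-integrable Q (EFin \o f) ->
  m.-integrable Q (EFin \o (fun v => a * f v)).
Proof. by move=> fi; exact: (integrableZl mQ a fi). Qed.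

Let add_integrable (f g : T -> R) : m.-integrable Q (EFin \o f) ->
  m.-integrable Q (EFin \o g) -> m.-integrable Q (EFin \o (fun v => f v + g v)).
Proof. by move=> fi gi; exact: (integrableD mQ fi gi). Qed.

Let affine_integral (a b c : R) :
  (\int[m]_(v in Q) (a - (b * cos (p v) + c * sin (p v)))%:E =
   (a * q - (b * C + c * S))%:E)%E.
Proof.
have i2 := add_integrable (scale_integrable b cos_integrable) (scale_integrable c sin_integrable).
have i3 := cst_integrable a.
rewrite integral_Rintegral; last first.
  rewrite (_ : _ \o _ = EFin \o (fun v => a + (-1) * (b * cos (p v) + c * sin (p v)))).
    by apply: add_integrable => //; exact: scale_integrable.
  by apply/funext => v /=; rewrite mulN1r.
rewrite RintegralB// Rintegral_cst// RintegralD//; try exact: scale_integrable.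
by rewrite !RintegralZl.
Qed.

(** The double integral of [cos (p u - p v)] is the sum of the squares of the
    integrals of [cos \o p] and [sin \o p]. *)
Lemma pair_phase_integral :
  (\int[m]_(u in Q) \int[m]_(v in Q) (1 - cos (p u - p v))%:E =
   (q ^+ 2 - C ^+ 2 - S ^+ 2)%:E)%E.
Proof.
transitivity (\int[m]_(u in Q) (q - (C * cos (p u) + S * sin (p u)))%:E)%E.
  apply: eq_integral => u _.
  transitivity (\int[m]_(v in Q) (1 - (cos (p u) * cos (p v) + sin (p u) * sin (p v)))%:E)%E.
    by apply: eq_integral => v _; rewrite cosB.
  by rewrite affine_integral; congr _%:E; ring.
by rewrite affine_integral; congr _%:E; ring.
Qed.

Lemma pair_phase_integral_le :
  (\int[m]_(u in Q) \int[m]_(v in Q) (1 - cos (p u - p v))%:E <= (q ^+ 2)%:E)%E.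
Proof.
rewrite pair_phase_integral lee_fin.
by have := sqr_ge0 C; have := sqr_ge0 S; lra.
Qed.

Lemma pair_phase_integral_le_small : (forall u, Q u -> `|p u| <= 1) ->
  (\int[m]_(u in Q) \int[m]_(v in Q) (1 - cos (p u - p v))%:E <=
   (3 / 4 * q ^+ 2)%:E)%E.
Proof.
move=> p1; rewrite pair_phase_integral lee_fin.
have q0 : 0 <= q by exact: fine_ge0.
suff : q / 2 <= C by have := sqr_ge0 S; nra.
rewrite -lee_fin -integral_Rintegral//.
rewrite (_ : (q / 2)%:E = \int[m]_(u in Q) (1 / 2)%:E)%E; last first.
  rewrite integral_Rintegral; last exact: cst_integrable.
  by rewrite Rintegral_cst// -/q; congr _%:E; ring.
apply: le_integral => //; first exact: cst_integrable.
move=> u /set_mem Qu; rewrite lee_fin.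
have := one_sub_cos_le (p u).
have : p u ^+ 2 <= 1 by rewrite -real_normK ?num_real// expr_le1// p1.
by lra.
Qed.

End positive_definite.

(** * Estimates on the exponent *)

Lemma le_of_relative_error {R : realType} (q s : R) : 0 <= s ->
  (forall t, 0 < t -> q <= s * (1 + t * q)) -> q <= s.
Proof.
move=> s0 key; rewrite leNgt; apply/negP => sq.
have q0 : 0 < q by exact: le_lt_trans sq.
have [sE|sN0] := eqVneq s 0; first by have := key 1 ltr01; rewrite sE; lra.
have s1 : 0 < s by rewrite lt_neqAle eq_sym sN0.
have t0 : 0 < (q - s) / (2 * s * q) by rewrite divr_gt0 ?mulr_gt0// subr_gt0.
have := key _ t0.
rewrite (_ : s * _ = (s + q) / 2); first by lra.
by field; rewrite sN0 gt_eqF.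
Qed.

(** The loss in comparing the exponents at two frequencies of equal modulus. *)
Definition exponent_const (R : realType) (d : nat) : R := 48 * d%:R ^+ 4.

(** The loss in bounding the tail of the law by the exponent. *)
Definition tail_const (R : realType) (d : nat) : R := 24 * d%:R ^+ 2.

Section exponent_estimates.
Context {R : realType} {d : nat} (d0 : (0 < d)%N).
Context {disp : measure_display} {Omega : measurableType disp}.
Variables (P : probability Omega R) (X : R -> Omega -> 'rV[R]_d).
Variable psi : 'rV[R]_d -> R.
Hypothesis mX : forall t, 0 <= t -> measurable_fun setT (X t).
Hypothesis iuX : isotropic_unimodal_process P X.
Hypothesis psiX : char_exponent P X psi.
Local Notation M := (exponent_const R d).
Implicit Types (t u r : R) (xi eta x : 'rV[R]_d).

Lemma law_measure t : 0 < t -> exists2 m : {measure set 'rV[R]_d -> \bar R},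
  isotropic_unimodal m & m = pushforward P (X t) :> (set 'rV[R]_d -> \bar R).
Proof.
move=> t0; have mXt := mX (ltW t0).
have : isotropic_unimodal (pushforward P (X t)) by exact: iuX.
by unshelve (exists (pushforward P (X t))).
Qed.

Lemma phase_expectation t xi : 0 <= t ->
  (\int[P]_w (1 - cos (inner xi (X t w)))%:E = (1 - expR (- t * psi xi))%:E)%E.
Proof.
move=> t0; have [cosE _] := psiX xi t0.
have mc : measurable_fun setT (fun w => cos (inner xi (X t w))).
  apply: measurable_cos_comp; apply: (measurableT_comp (measurable_inner xi)).
  exact: mX.
have ic : P.-integrable setT (EFin \o (fun w => cos (inner xi (X t w)))).
  apply: (@bounded_integrable _ _ _ P setT _ _ _ 1) => //; last by move=> w; exact: cos_max.
  exact: (le_lt_trans (probability_le1 P measurableT) (ltry 1)).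
have i1 : P.-integrable setT (EFin \o cst (1 : R)) by exact: finite_measure_integrable_cst.
under eq_integral do rewrite EFinB.
rewrite (integralB_EFin measurableT i1 ic).
have -> : (\int[P]_w (cst (1 : R) w)%:E = 1)%E.
  by rewrite (integral_cst P measurableT 1%:E) mul1e; exact: probability_setT.
by rewrite EFinB -cosE fineK//; exact: integrable_fin_num.
Qed.

Lemma phase_expectation_law t xi : 0 <= t ->
  (\int[pushforward P (X t)]_x (1 - cos (inner xi x))%:E =
   (1 - expR (- t * psi xi))%:E)%E.
Proof.
move=> t0; rewrite -phase_expectation// (ge0_integral_pushforward (mX t0))//.
by apply/measurable_EFinP; apply: measurable_one_sub_cos; exact: measurable_inner.
Qed.

Lemma exponent_ge0 xi : 0 <= psi xi.
Proof.
have : (0 <= (1 - expR (- 1 * psi xi))%:E :> \bar R)%E.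
  rewrite -phase_expectation//; apply: integral_ge0 => w _.
  by rewrite lee_fin one_sub_cos_ge0.
by rewrite lee_fin subr_ge0 mulN1r expR_le1 oppr_le0.
Qed.

Lemma exponent_const_ge1 : 1 <= M.
Proof.
have : 1 <= d%:R ^+ 4 :> R by rewrite -natrX ler1n expn_gt0 d0.
by rewrite /exponent_const; lra.
Qed.

(** The comparison between the laws at time [t] concerns [1 - exp (- t psi)];
    it passes to the exponents as [t] tends to 0, where the relative error made
    in replacing [1 - exp (- t psi)] by [t psi] vanishes. *)
Lemma exponent_comparison (lambda : R) eta xi : 1 <= lambda ->
  eucl_norm eta <= lambda * eucl_norm xi ->
  psi eta <= M * lambda ^+ 2 * psi xi.
Proof.
move=> l1 hle; set C := M * _.
have C0 : 0 <= C by rewrite mulr_ge0 ?sqr_ge0// (le_trans ler01 exponent_const_ge1).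
have p0 := exponent_ge0 xi; have q0 := exponent_ge0 eta.
have key t : 0 < t -> psi eta <= C * psi xi * (1 + t * psi eta).
  move=> t0; have t0' := ltW t0.
  have [mt iumt hmt] := law_measure t0.
  have := phase_integral_comparison iumt d0 l1 hle.
  rewrite hmt !phase_expectation_law// -EFinM lee_fin -/exponent_const -/C => h.
  have e1 : 1 - expR (- t * psi xi) <= t * psi xi.
    by have := expR_ge1Dx (- t * psi xi); lra.
  have e2 : t * psi eta <= (1 + t * psi eta) * (1 - expR (- t * psi eta)).
    rewrite mulNr expRN.
    have := expR_ge1Dx (t * psi eta); have := expR_gt0 (t * psi eta).
    set E := expR _ => E0 hE.
    suff : (1 + t * psi eta) * E^-1 <= 1 by nra.
    by rewrite ler_pdivrMr// mul1r.
  have tq : 0 <= t * psi eta by rewrite mulr_ge0.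
  rewrite -(ler_pM2l t0) (le_trans e2)//.
  rewrite [leRHS](_ : _ = (1 + t * psi eta) * (C * (t * psi xi))); last by ring.
  apply: ler_wpM2l; first by lra.
  by rewrite (le_trans h)//; apply: ler_wpM2l.
by apply: le_of_relative_error => //; rewrite mulr_ge0.
Qed.

Lemma psi_star_ub u xi : 0 < u -> eucl_norm xi <= u -> psi xi <= psi_star psi u.
Proof.
move=> u0 xiu; apply: ub_le_sup; last by exists xi.
have [z zu] := @exists_eucl_norm R d u d0 (ltW u0).
exists (M * 1 ^+ 2 * psi z) => _ [y /= yu <-].
by apply: exponent_comparison; rewrite // zu mul1r.
Qed.

Lemma psi_star_le u xi : eucl_norm xi = u -> psi_star psi u <= M * psi xi.
Proof.
move=> xiu; apply: ge_sup.
  by exists (psi xi), xi => //=; rewrite xiu.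
move=> _ [y /= yu <-].
have := @exponent_comparison 1 y xi; rewrite expr1n mulr1 mul1r xiu.
by apply.
Qed.

Lemma psi_star_mono u v : 0 < u -> u <= v -> psi_star psi u <= psi_star psi v.
Proof.
move=> u0 uv; have [x xu] := @exists_eucl_norm R d u d0 (ltW u0).
apply: ge_sup; first by exists (psi x), x => //=; rewrite xu.
move=> _ [y /= yu <-]; apply: psi_star_ub; first exact: lt_le_trans uv.
exact: le_trans uv.
Qed.

Hypothesis psi0 : exists xi, psi xi != 0.

(** By comparison, a zero of the exponent away from the origin would force the
    exponent to vanish everywhere. *)
Lemma exponent_gt0 xi : xi != 0 -> 0 < psi xi.
Proof.
move=> xi0; have [eta eta0] := psi0.
have q0 : 0 < psi eta by rewrite lt_neqAle eq_sym eta0 exponent_ge0.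
rewrite lt_neqAle exponent_ge0 andbT eq_sym; apply/eqP => xiE.
have n0 : 0 < eucl_norm xi by rewrite eucl_norm_gt0.
have := @exponent_comparison (1 + eucl_norm eta / eucl_norm xi) eta xi.
rewrite xiE mulr0 mulrDl mul1r divfK ?gt_eqF// lerDl lerDr.
by rewrite divr_ge0 ?eucl_norm_ge0// => /(_ isT isT); rewrite leNgt q0.
Qed.

Lemma psi_star_gt0 u : 0 < u -> 0 < psi_star psi u.
Proof.
move=> u0; have [x xu] := @exists_eucl_norm R d u d0 (ltW u0).
apply: (@lt_le_trans _ _ (psi x)); last by rewrite psi_star_ub// xu.
by rewrite exponent_gt0// -eucl_norm_gt0 xu.
Qed.

(** Since the exponent grows at most quadratically, at the frequency [a / r] it
    has lost at most a factor [a ^+ 2] with respect to the frequency [1 / r]. *)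
Lemma psi_star_le_exponent r a xi : 0 < r -> 0 < a <= 1 ->
  a <= r * eucl_norm xi -> a ^+ 2 * psi_star psi r^-1 <= M ^+ 2 * psi xi.
Proof.
move=> r0 /andP[a0 a1] axi.
have ri : 0 < r^-1 by rewrite invr_gt0.
have [z zr] := @exists_eucl_norm R d r^-1 d0 (ltW ri).
have M0 : 0 <= M by rewrite (le_trans ler01 exponent_const_ge1).
have h1 := psi_star_le zr.
have h2 : psi z <= M * (a^-1) ^+ 2 * psi xi.
  apply: exponent_comparison; first by rewrite invf_ge1.
  by rewrite zr ler_pdivlMl// mulrC ler_pdivrMl.
have h3 : psi_star psi r^-1 <= M * (M * (a^-1) ^+ 2 * psi xi).
  by rewrite (le_trans h1)//; apply: ler_wpM2l.
have a2 : 0 <= a ^+ 2 by rewrite sqr_ge0.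
apply: (le_trans (ler_wpM2l a2 h3)).
by rewrite le_eqVlt; apply/orP; left; apply/eqP; field; rewrite gt_eqF.
Qed.

Lemma tail_probability_le t r : 0 < t -> 0 < r ->
  (P [set w | r < eucl_norm (X t w)]%R <= (tail_const R d * (t * psi_star psi r^-1))%:E)%E.
Proof.
move=> t0 r0; have t0' := ltW t0.
have ri : 0 < r^-1 by rewrite invr_gt0.
have [z zr] := @exists_eucl_norm R d r^-1 d0 (ltW ri).
have [mt iumt hmt] := law_measure t0.
have := tail_le_phase_integral iumt d0 r0 zr.
rewrite hmt phase_expectation_law// -EFinM => /le_trans; apply.
rewrite lee_fin; apply: ler_wpM2l; first by rewrite mulr_ge0// sqr_ge0.
apply: (@le_trans _ _ (t * psi z)).
  by have := expR_ge1Dx (- t * psi z); lra.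
by rewrite ler_pM2l// psi_star_ub// zr.
Qed.

End exponent_estimates.

(** * Potential measure as an integral over time *)

Section integral_without_measurability.
Context {R : realType} {disp} {T : measurableType disp}.
Variable mu : {measure set T -> \bar R}.
Local Open Scope ereal_scope.
Import HBNNSimple.

(** For functions which may fail to be measurable: the integral of a nonnegative
    function is the supremum of those of the simple functions below it. *)
Lemma nonneg_integral_mono (f g : T -> \bar R) : (forall x, 0 <= f x) ->
  (forall x, f x <= g x) -> \int[mu]_x f x <= \int[mu]_x g x.
Proof.
move=> f0 fg; have g0 x : 0 <= g x by exact: le_trans (fg x).
rewrite !ge0_integralTE//; apply: ereal_sup_le => _ [h /= hf <-].
by exists h => // x; exact: le_trans (fg x).
Qed.

Lemma integral_eq_off_null (N : set T) (f g : T -> \bar R) : measurable N ->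
  mu N = 0 -> (forall x, 0 <= f x) -> (forall x, 0 <= g x) ->
  measurable_fun setT g -> (forall x, ~ N x -> f x = g x) ->
  \int[mu]_x f x = \int[mu]_x g x.
Proof.
move=> mN N0 f0 g0 mg fg.
have offN h : measurable_fun setT h -> (forall x, 0 <= h x) ->
    \int[mu]_x h x = \int[mu]_x (h \_ (~` N)) x.
  by move=> mh h0; rewrite (ge0_negligible_integral mN)// setTD integral_mkcond.
apply/eqP; rewrite eq_le; apply/andP; split; last first.
  rewrite offN//; apply: nonneg_integral_mono => x; rewrite patchE; case: ifPn => //.
  by move=> /set_mem Nx; rewrite fg.
rewrite ge0_integralTE//; apply: ge_ereal_sup => _ [h /= hf <-].
rewrite -integralT_nnsfun offN; last 2 first.
- exact/measurable_EFinP/measurable_funPT.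
- by move=> x; rewrite lee_fin.
apply: nonneg_integral_mono => x; rewrite patchE; case: ifPn => //.
- by move=> _; rewrite lee_fin.
- by move=> /set_mem Nx; rewrite -fg.
Qed.

End integral_without_measurability.

Section potential.
Context {R : realType} {d : nat}.
Context {disp : measure_display} {Omega : measurableType disp}.
Variables (P : probability Omega R) (X : R -> Omega -> 'rV[R]_d).
Hypothesis mX : forall t, 0 <= t -> measurable_fun setT (X t).
Hypothesis cX : {ae P, forall w, cadlag (X ^~ w)}.

(** At a nonnegative time [t], the first point strictly after [t] of the grid of
    step [1 / (n + 1)]. *)
Definition grid (n : nat) (t : R) : R :=
  (Num.truncn (n.+1%:R * t)).+1%:R / n.+1%:R.

Lemma grid_gt n t : Num.max t 0 < grid n t.
Proof.
rewrite gt_max divr_gt0// andbT ltr_pdivlMr// mulrC.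
exact: truncnS_gt.
Qed.

Lemma grid_le n t : grid n t <= Num.max t 0 + n.+1%:R^-1.
Proof.
rewrite /grid ler_pdivrMr// mulrDl mulVf ?pnatr_eq0// -natr1 lerD2r.
have [t0|t0] := leP 0 t.
  by rewrite mulrC truncn_le mulr_ge0.
rewrite mul0r.
suff /truncn0Pn -> : ~~ (1 <= n.+1%:R * t) by [].
by rewrite -ltNge (@lt_trans _ _ 0)// pmulr_rlt0.
Qed.

Lemma grid_cvg t : grid ^~ t @ \oo --> Num.max t 0.
Proof.
apply: (@squeeze_cvgr _ _ _ _ (cst (Num.max t 0))
  (fun n => Num.max t 0 + n.+1%:R^-1)).
- by near=> n; rewrite (ltW (grid_gt _ _)) grid_le.
- exact: cvg_cst.
- rewrite -[X in _ --> X]addr0; apply: cvgD; first exact: cvg_cst.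
  exact: cvg_harmonic.
Unshelve. all: by end_near. Qed.

Lemma measurable_grid_path n :
  measurable_fun setT (fun p : R * Omega => X (grid n p.1) p.2).
Proof.
move=> _ B mB; rewrite setTI.
rewrite (_ : _ @^-1` B = \bigcup_k
   ([set t : R | Num.truncn (n.+1%:R * t) = k] `*`
    (X (k.+1%:R / n.+1%:R) @^-1` B))).
  apply: bigcupT_measurable => k; apply: measurableX.
    rewrite (_ : [set _ | _] = (fun t : R => n.+1%:R * t) @^-1`
        (if k is k'.+1 then `[k%:R, k.+1%:R[%classic else `]-oo, 1[%classic)).
      rewrite -[X in measurable X]setTI.
      have mf : measurable_fun setT (fun t : R => n.+1%:R * t).
        by apply: measurable_funM.
      by apply: mf => //; case: (k).
    apply/seteqP; split=> [t /=|t]; case: k => [|k] /=; rewrite in_itv/=.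
    - move=> h; rewrite ltNge; apply/negP => h1.
      by have := truncn_gt_nat (n.+1%:R * t) 0; rewrite h h1.
    - move=> h; have t0 : 0 <= n.+1%:R * t.
        have := truncn_gt_nat (n.+1%:R * t) 0; rewrite h => /esym.
        exact: le_trans.
      by move: h => /eqP; rewrite truncn_eq.
    - by move=> h; apply/truncn0Pn; rewrite -ltNge.
    - exact: truncn_def.
  have k0 : 0 <= k.+1%:R / n.+1%:R :> R by rewrite divr_ge0.
  by rewrite -[X in measurable X]setTI; exact: mX.
apply/seteqP; split=> [[t w] /= Bw|[t w] [k _ [/= tk Bw]]].
  by exists (Num.truncn (n.+1%:R * t)).
by rewrite /grid tk.
Qed.

(** By right-continuity of the paths, the process sampled on the grids converges
    to the process, jointly in time and chance. *)
Lemma exists_joint_version : exists2 N, measurable N /\ P N = 0%E &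
  exists2 Y : R * Omega -> 'rV[R]_d, measurable_fun setT Y &
    forall t w, 0 <= t -> ~ N w -> Y (t, w) = X t w.
Proof.
have [N [mN PN cN]] := cX; exists N => //.
exists (fun p => \1_(~` N) p.2 *: X (Num.max p.1 0) p.2); last first.
  by move=> t w t0 Nw; rewrite (max_idPl t0) /= indicE mem_set// scale1r.
apply/measurable_fun_rVP => i.
apply: (@measurable_fun_cvg _ _ _ _
  (fun n (p : R * Omega) => \1_(~` N) p.2 * rV_coord i (X (grid n p.1) p.2))).
- move=> n; apply: measurable_funM.
    apply: (measurableT_comp _ measurable_snd).
    by apply: measurable_indic; exact: measurableC.
  exact: (measurableT_comp (measurable_rV_coord i) (measurable_grid_path n)).
- move=> [t w] _ /=; rewrite /rV_coord mxE.
  rewrite indicE; case: (boolP (w \in ~` N)) => [/set_mem Nw|_]; last first.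
    by rewrite mul0r; under eq_fun do rewrite mul0r; exact: cvg_cst.
  under eq_fun do rewrite mul1r; rewrite mul1r.
  have [rc _] : cadlag (X ^~ w) by apply: contrapT => /cN.
  have t0 : 0 <= Num.max t 0 by rewrite le_max lexx orbT.
  have rci : X s w ord0 i @[s --> (Num.max t 0)^'+] --> X (Num.max t 0) w ord0 i.
    apply: (@continuous_cvg _ _ _ _ _ _ (fun M : 'rV[R]_d => M ord0 i)) (rc _ t0).
    exact: coord_continuous.
  move/cvg_at_rightP : rci; apply; split; last exact: grid_cvg.
  by move=> n; exact: grid_gt.
Qed.

(** Tonelli's theorem, applied to a jointly measurable version: outside a null
    set the occupation times are the same. *)
Lemma potential_measureE A : measurable A ->
  measurable_fun (`[0%R, +oo[%classic : set R) (fun t => P (X t @^-1` A)) /\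
  potential_measure P X A =
  (\int[lebesgue_measure]_(t in `[0%R, +oo[) P (X t @^-1` A))%E.
Proof.
move=> mA; have [N [mN PN] [Y mY YX]] := exists_joint_version.
pose D : set R := `[0%R, +oo[%classic.
pose E : set (R * Omega) := (D `*` ~` N) `&` Y @^-1` A.
have mE : measurable E.
  apply: measurableI; last by rewrite -[X in measurable X]setTI; exact: mY.
  by apply: measurableX; [exact: measurable_itv|exact: measurableC].
pose f (p : R * Omega) : \bar R := (\1_E p)%:E.
have f0 p : (0 <= f p)%E by rewrite lee_fin.
have mf : measurable_fun setT f.
  by apply/measurable_EFinP; apply: measurable_indic.
have slice t : (\int[P]_w f (t, w) = ((fun t => P (X t @^-1` A)) \_ D) t)%E.
  rewrite patchE; case: ifPn => [/set_mem Dt|Dt].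
    have t0 : 0 <= t by move: Dt; rewrite /D/= in_itv/= andbT.
    have mXA : measurable (X t @^-1` A).
      by rewrite -[X in measurable X]setTI; exact: mX.
    transitivity (\int[P]_w (\1_(X t @^-1` A) w)%:E)%E; last first.
      by rewrite integral_indic// setIT.
    apply: (integral_eq_off_null mN PN) => //.
      by apply/measurable_EFinP; apply: measurable_indic.
    move=> w Nw; rewrite /f !indicE; congr ((nat_of_bool _)%:R%:E).
    apply/idP/idP => /set_mem h; apply/mem_set.
      by case: h => _ /=; rewrite YX.
    by split => //=; rewrite YX.
  apply: integral0_eq => w _; rewrite /f indicE memNset//= => -[[/= Dt' _] _].
  by move/negP : Dt; apply; exact/mem_set.
split.
  apply/measurable_restrictT; first exact: measurable_itv.
  have := @measurable_fun_fubini_tonelli_F _ _ _ _ _ P f mf f0.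
  by apply: eq_measurable_fun => t _; rewrite -slice.
transitivity (\int[P]_w \int[lebesgue_measure]_t f (t, w))%E.
  apply: (integral_eq_off_null mN PN).
  - by move=> w; apply: integral_ge0 => t _; rewrite lee_fin.
  - by move=> w; exact: integral_ge0.
  - exact: measurable_fun_fubini_tonelli_G.
  - move=> w Nw; rewrite integral_mkcond; apply: eq_integral => t _.
    rewrite patchE /f; case: ifPn => [/set_mem Dt|Dt]; last first.
      by rewrite indicE memNset//= => -[[/= Dt' _] _]; move/negP : Dt; apply; exact/mem_set.
    have t0 : 0 <= t by move: Dt; rewrite /= in_itv/= andbT.
    rewrite !indicE; congr ((nat_of_bool _)%:R%:E).
    apply/idP/idP => /set_mem h; apply/mem_set.
      by split => //=; rewrite YX.
    by case: h => _ /=; rewrite YX.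
rewrite -(@fubini_tonelli _ _ _ _ _ lebesgue_measure P f)// [RHS]integral_mkcond.
by apply: eq_integral => t _; rewrite slice.
Qed.

End potential.

(** * Small balls by Fourier averaging *)

Section cubes.
Context {R : realType} {d : nat}.

Lemma measurable_rV_sub :
  measurable_fun setT (fun z : 'rV[R]_d * 'rV[R]_d => z.1 - z.2).
Proof.
apply/measurable_fun_rVP => i.
rewrite (_ : _ \o _ = (rV_coord i \o fst) \- (rV_coord i \o snd)); last first.
  by apply/funext => z /=; rewrite /rV_coord !mxE.
by apply: measurable_funB; apply: (measurableT_comp (measurable_rV_coord i)).
Qed.

Lemma measurable_inner_pair : measurable_fun setT
  (fun z : 'rV[R]_d * 'rV[R]_d => inner z.1 z.2).
Proof.
apply: measurable_sum => i; apply: measurable_funM;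
  by apply: (measurableT_comp (measurable_coord i)).
Qed.

Definition cube (c : 'rV[R]_d) (a : R) : set 'rV[R]_d :=
  box (fun i => `[(c ord0 i - a)%R, (c ord0 i + a)%R]%classic).

Lemma measurable_cube c a : measurable (cube c a).
Proof. by apply: measurable_box => i; exact: measurable_itv. Qed.

Lemma cubeP c a x : cube c a x <-> forall i, `|x ord0 i - c ord0 i| <= a.
Proof.
split=> h i; have := h i; rewrite /= in_itv/= ler_norml /rV_coord.
  by move=> /andP[h1 h2]; apply/andP; split; lra.
by move=> /andP[h1 h2]; apply/andP; split; lra.
Qed.

Lemma lebesgue_cube c a : 0 <= a ->
  lebesgue_rV R d (cube c a) = ((2 * a) ^+ d)%:E.
Proof.
move=> a0; rewrite lebesgue_rV_boxE; last by move=> i; exact: measurable_itv.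
rewrite (eq_bigr (fun=> (2 * a)%:E)).
  by rewrite -(big_morph EFin (@EFinM R) (erefl 1%:E)) prodr_const card_ord.
move=> i _; rewrite lebesgue_measure_itv/= lte_fin.
have [|h] := ltP; first by move=> _; rewrite -EFinB; congr _%:E; ring.
by congr _%:E; lra.
Qed.

End cubes.

Section small_ball.
Context {R : realType} {d : nat} (d0 : (0 < d)%N).
Context {disp : measure_display} {Omega : measurableType disp}.
Variables (P : probability Omega R) (X : R -> Omega -> 'rV[R]_d).
Variable psi : 'rV[R]_d -> R.
Hypothesis mX : forall t, 0 <= t -> measurable_fun setT (X t).
Hypothesis psiX : char_exponent P X psi.

Local Notation leb := (lebesgue_rV R d).

(** Average [cos <u - v, X t>] over pairs [u], [v] of points of the cube of half
    side [1 / (d r)]. For each path this average is nonnegative, and at least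
    1/4 when the norm of [X t] is at most [r]. Its expectation is the average of
    [exp (- t psi (u - v))], which is at most [e] except for the pairs whose
    coordinates are all [delta]-close. *)
Lemma small_ball_fourier (t r delta e : R) : 0 <= t -> 0 < r -> 0 <= delta ->
  d%:R * r * delta <= 1 -> 0 <= e <= 1 ->
  (forall z : 'rV[R]_d, (exists i, delta < `|z ord0 i|) -> expR (- t * psi z) <= e) ->
  (P [set w | eucl_norm (X t w) <= r]%R <=
   (4 * (e + (d%:R * r * delta) ^+ d))%:E)%E.
Proof.
move=> t0 r0 delta0 hdelta /andP[e0 e1] he.
have dr0 : 0 < d%:R * r by rewrite mulr_gt0// ltr0n.
pose s := (d%:R * r)^-1; have s0 : 0 < s by rewrite invr_gt0.
pose Q : set 'rV[R]_d := cube 0 s.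
have mQ : measurable Q by exact: measurable_cube.
pose q := (2 * s) ^+ d.
have q0 : 0 < q by rewrite exprn_gt0// mulr_gt0.
have lQ : leb Q = q%:E by rewrite lebesgue_cube// ltW.
pose k := (2 * delta) ^+ d.
have kq : k = (d%:R * r * delta) ^+ d * q.
  rewrite /k /q -exprMn; congr (_ ^+ d); rewrite /s; field.
  by rewrite gt_eqF//= pnatr_eq0 gt_eqF.
pose phase (w : Omega) (u v : 'rV[R]_d) : R := 1 - cos (inner (u - v) (X t w)).
have phase0 w u v : 0 <= phase w u v by exact: one_sub_cos_ge0.
have mphase : measurable_fun setT
    (fun y : (Omega * 'rV[R]_d) * 'rV[R]_d => phase y.1.1 y.1.2 y.2).
  apply: measurable_one_sub_cos.
  have mg : measurable_fun setT (fun y : (Omega * 'rV[R]_d) * 'rV[R]_d =>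
      (y.1.2 - y.2, X t y.1.1)).
    apply/measurable_fun_pairP; split => /=.
      have mh : measurable_fun setT (fun y : (Omega * 'rV[R]_d) * 'rV[R]_d =>
          (y.1.2, y.2)).
        apply/measurable_fun_pairP; split => /=; last exact: measurable_snd.
        exact: (measurableT_comp measurable_snd measurable_fst).
      exact: (measurableT_comp measurable_rV_sub mh).
    apply: (measurableT_comp (mX t0)).
    exact: (measurableT_comp measurable_fst measurable_fst).
  exact: (measurableT_comp measurable_inner_pair mg).
pose F (y : (Omega * 'rV[R]_d) * 'rV[R]_d) : \bar R :=
  (\1_Q y.1.2 * \1_Q y.2 * phase y.1.1 y.1.2 y.2)%:E.
have F0 y : (0 <= F y)%E by rewrite lee_fin !mulr_ge0.
have mF : measurable_fun setT F.
  have mI : measurable_fun setT (\1_Q : 'rV[R]_d -> R) by exact: measurable_indic.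
  apply/measurable_EFinP; apply: measurable_funM => //; apply: measurable_funM.
    apply: (measurableT_comp mI).
    exact: (measurableT_comp measurable_snd measurable_fst).
  exact: (measurableT_comp mI measurable_snd).
pose G y : \bar R := (\int[leb]_v F (y, v))%E.
have G0 y : (0 <= G y)%E by exact: integral_ge0.
have mG : measurable_fun setT G.
  exact: (@measurable_fun_fubini_tonelli_F _ _ _ _ _ leb F mF F0).
have GE w : (\int[leb]_u G (w, u) =
    \int[leb]_(u in Q) \int[leb]_(v in Q)
      (1 - cos (inner u (X t w) - inner v (X t w)))%:E)%E.
  rewrite [RHS]integral_mkcond; apply: eq_integral => u _.
  rewrite patchE /G; case: ifPn => Qu; last first.
    by apply: integral0_eq => v _; rewrite /F /= indicE (negPf Qu) !mul0r.
  rewrite [RHS]integral_mkcond; apply: eq_integral => v _.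
  rewrite patchE /F /= !indicE Qu; case: ifPn => Qv; last by rewrite mulr0 mul0r.
  rewrite mulr1 mul1r /phase /=; congr (1 - cos _)%:E.
  rewrite /inner -sumrB; apply: eq_bigr => i _; rewrite !mxE; ring.
pose B := [set w | eucl_norm (X t w) <= r].
have mB : measurable B.
  apply: measurable_le_set => //.
  exact: (measurableT_comp measurable_eucl_norm (mX t0)).
have upper : (\int[P]_w \int[leb]_u G (w, u) + (q ^+ 2 / 4)%:E * P B <=
    (q ^+ 2)%:E)%E.
  have -> : (P B = \int[P]_w (\1_B w)%:E)%E by rewrite integral_indic// setIT.
  have mFF : measurable_fun setT (fun w => \int[leb]_u G (w, u))%E.
    exact: (@measurable_fun_fubini_tonelli_F _ _ _ _ _ leb G mG G0).
  have mI : measurable_fun setT (fun w => (\1_B w)%:E : \bar R).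
    by apply/measurable_EFinP; apply: measurable_indic.
  rewrite -ge0_integralZl//; last by rewrite lee_fin divr_ge0// sqr_ge0.
  rewrite -ge0_integralD//; last 3 first.
  - by move=> w _; exact: integral_ge0.
  - by move=> w _; rewrite -EFinM lee_fin mulr_ge0// divr_ge0// sqr_ge0.
  - by apply: emeasurable_funM.
  apply: (@le_trans _ _ (\int[P]_w (cst (q ^+ 2)%:E w))%E); last first.
    rewrite integral_cst//= -[leRHS]mule1; apply: lee_wpmul2l.
      by rewrite lee_fin sqr_ge0.
    exact: probability_le1.
  apply: ge0_le_integral => //=.
  - move=> w _; apply: adde_ge0; first exact: integral_ge0.
    by rewrite -EFinM lee_fin mulr_ge0// divr_ge0// sqr_ge0.
  - by apply: emeasurable_funD => //; apply: emeasurable_funM.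
  move=> w _; rewrite GE.
  have mi : measurable_fun setT (fun u => inner u (X t w)).
    exact: (measurableT_comp measurable_inner_pair (pair2_measurable (X t w))).
  have Qfin : (leb Q < +oo)%E by rewrite lQ ltry.
  have qE : fine (leb Q) = q by rewrite lQ.
  rewrite indicE; case: (boolP (w \in B)) => [/set_mem Bw|_]/=; last first.
    by rewrite mule0 adde0 -qE; exact: (pair_phase_integral_le mQ Qfin mi).
  rewrite mule1.
  have := pair_phase_integral_le_small mQ Qfin mi; rewrite qE => /(_ _)/(leeD2r _).
  move=> /(_ (q ^+ 2 / 4)%:E) hle; apply: le_trans (hle _) _; last first.
    by rewrite -EFinD lee_fin; lra.
  move=> u /cubeP Qu.
  apply: (le_trans (ler_norm_sum _ _ _)).
  apply: (@le_trans _ _ (\sum_(i < d) s * r)).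
    apply: ler_sum => i _; rewrite normrM ler_pM//.
      by have := Qu i; rewrite mxE subr0.
    exact: le_trans (coord_le_eucl_norm _ _) Bw.
  rewrite sumr_const card_ord -[leLHS]mulr_natl /s.
  by rewrite mulrCA mulVf// gt_eqF.
have swap : (\int[P]_w \int[leb]_u G (w, u) =
    \int[leb]_u \int[leb]_v \int[P]_w F ((w, u), v))%E.
  rewrite (@fubini_tonelli _ _ _ _ _ P leb G)//.
  apply: eq_integral => u _.
  rewrite /G -(@fubini_tonelli _ _ _ _ _ P leb (fun y => F ((y.1, u), y.2)))//.
  have mh : measurable_fun setT (fun y : Omega * 'rV[R]_d => ((y.1, u), y.2)).
    apply/measurable_fun_pairP; split => /=; last exact: measurable_snd.
    apply/measurable_fun_pairP; split => /=; last exact: measurable_cst.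
    exact: measurable_fst.
  exact: (measurableT_comp mF mh).
have lower : (((1 - e) * (q - k) * q)%:E <=
    \int[leb]_u \int[leb]_v \int[P]_w F ((w, u), v))%E.
  have kqle : k <= q.
    rewrite kq ler_piMl// ?exprn_ile1// ?mulr_ge0// ltW//.
  have c0 : 0 <= (1 - e) * (q - k) by rewrite mulr_ge0// subr_ge0.
  rewrite EFinM -lQ -[Q]setIT -integral_indic// -ge0_integralZl//; last first.
    by apply/measurable_EFinP; apply: measurable_indic.
  apply: nonneg_integral_mono => u; first by rewrite -EFinM lee_fin mulr_ge0.
  rewrite indicE; case: (boolP (u \in Q)) => Qu/=; last first.
    by rewrite mule0; apply: integral_ge0 => v _; exact: integral_ge0.
  rewrite mule1.
  have mC := measurable_cube u delta.
  have mQC : measurable (Q `\` cube u delta) by exact: measurableD.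
  apply: (@le_trans _ _ (\int[leb]_v ((1 - e)%:E * (\1_(Q `\` cube u delta) v)%:E))%E).
    rewrite ge0_integralZl//; last 2 first.
    - by apply/measurable_EFinP; apply: measurable_indic.
    - by rewrite lee_fin subr_ge0.
    rewrite integral_indic// setIT EFinM; apply: lee_wpmul2l.
      by rewrite lee_fin subr_ge0.
    rewrite EFinB leeBlDr//.
    have -> : k%:E = leb (cube u delta) by rewrite lebesgue_cube.
    rewrite -lQ (measureDI leb mQ mC) leeD2l//.
    by apply: le_measure; rewrite ?inE//; exact: measurableI.
  apply: nonneg_integral_mono => v.
    by rewrite -EFinM lee_fin mulr_ge0// subr_ge0.
  rewrite indicE; case: (boolP (v \in _)) => [/set_mem[Qv Cv]|_]/=; last first.
    by rewrite mule0; exact: integral_ge0.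
  rewrite mule1.
  rewrite (_ : (\int[P]_w _)%E = (1 - expR (- t * psi (u - v)))%:E); last first.
    rewrite -(phase_expectation mX psiX _ t0); apply: eq_integral => w _.
    by rewrite /F /= !indicE Qu mem_set// !mul1r.
  rewrite lee_fin lerD2l lerN2; apply: he.
  move/cubeP : Cv => /existsNP[i /negP]; rewrite -ltNge => hi.
  by exists i; rewrite !mxE distrC.
have [pr prE] : exists pr : R, P B = pr%:E.
  by exists (fine (P B)); rewrite fineK// fin_num_measure.
rewrite -/B prE lee_fin.
have := le_trans (leeD lower (lexx ((q ^+ 2 / 4)%:E * P B)%E)) _.
rewrite -swap => /(_ _ upper); rewrite prE -EFinM -EFinD lee_fin.
rewrite kq; set y := (d%:R * r * delta) ^+ d => h.
have y0 : 0 <= y by rewrite exprn_ge0// !mulr_ge0// ltW.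
suff : q ^+ 2 * pr <= q ^+ 2 * (4 * (e + y)).
  by rewrite ler_pM2l// exprn_gt0.
have : 0 <= q ^+ 2 * (e * y) by rewrite (mulr_ge0 (sqr_ge0 _))// mulr_ge0.
by move: h; nra.
Qed.

End small_ball.

(** * A power integral *)

Section decay_integral.
Context {R : realType}.
Variable kappa : R.
Hypothesis kappa0 : 0 < kappa.

Let base_gt0 t : 0 <= t -> 0 < 1 + kappa * t.
Proof. by move=> t0; rewrite ltr_pwDl// mulr_ge0// ltW. Qed.

Let derive_pow (a t : R) : 0 <= t ->
  is_derive t 1 (fun t => (1 + kappa * t) `^ a)
    (a * (1 + kappa * t) `^ (a - 1) * kappa).
Proof.
move=> t0.
have h1 : is_derive t 1 (fun t => 1 + kappa * t) kappa.
  have h : is_derive t (1 : R) (cst (1 : R) + kappa *: (@id R)) (0 + kappa *: (1 : R)).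
    exact: is_deriveD.
  by move: h; rewrite add0r /GRing.scale/= mulr1.
have h2 := is_derive1_powR a (base_gt0 t0).
exact: (@is_derive1_comp R (fun x : R => x `^ a) (fun t : R => 1 + kappa * t)
  t _ _ h2 h1).
Qed.

Lemma decay_integral :
  (\int[lebesgue_measure]_(t in `[0%R, +oo[) ((1 + kappa * t) `^ (- (5 / 4)))%:E =
   (4 / kappa)%:E)%E.
Proof.
pose F (t : R) : R := - (4 / kappa) * (1 + kappa * t) `^ (- (1 / 4)).
have dF (t : R) : 0 <= t -> is_derive t 1 F ((1 + kappa * t) `^ (- (5 / 4))).
  move=> t0; have h := derive_pow (- (1 / 4)) t0.
  have -> : (1 + kappa * t) `^ (- (5 / 4)) = - (4 / kappa) *:
      (- (1 / 4) * (1 + kappa * t) `^ (- (1 / 4) - 1) * kappa).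
    rewrite (_ : - (1 / 4) - 1 = - (5 / 4)); last by field.
    rewrite /GRing.scale/=; field; rewrite gt_eqF//.
  exact: is_deriveZ.
have contP (a t : R) : 0 <= t -> {for t, continuous (fun t : R => (1 + kappa * t) `^ a)}.
  move=> t0; apply: differentiable_continuous; apply/derivable1_diffP.
  by have := derive_pow a t0; case.
rewrite (@ge0_continuous_FTC2y _ _ F 0 0).
- rewrite /F mulr0 addr0 powR1 mulr1 sub0e -EFinN opprK//.
- by move=> t _; exact: powR_ge0.
- apply: continuous_in_subspaceT => t /set_mem; rewrite /= in_itv/= andbT.
  exact: contP.
- rewrite -[X in _ --> X](mulr0 (- (4 / kappa))).
  apply: cvgM; first exact: cvg_cst.
  apply/cvgrPdist_le => e e0; near=> t.
  rewrite sub0r normrN ger0_norm ?powR_ge0// powRN.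
  rewrite -[leRHS]invrK lef_pV2 ?posrE ?invr_gt0//; last first.
    rewrite powR_gt0//; apply: base_gt0; near: t; exact: nbhs_pinfty_ge.
  have -> : e^-1 = ((e^-1) ^+ 4) `^ (1 / 4).
    rewrite -powR_mulrn; last by rewrite invr_ge0 ltW.
    rewrite -powRrM (_ : 4 * (1 / 4) = 1); last by field.
    by rewrite powRr1// invr_ge0 ltW.
  have tpos : 0 <= t by near: t; exact: nbhs_pinfty_ge.
  apply: ge0_ler_powR.
  - by [].
  - by rewrite nnegrE exprn_ge0// invr_ge0 ltW.
  - by rewrite nnegrE ltW// base_gt0.
  - have : e^-1 ^+ 4 / kappa <= t.
      by near: t; apply: nbhs_pinfty_ge; exact: num_real.
    by rewrite ler_pdivrMr// mulrC; lra.
- by move=> t t0; have := dF t (ltW t0); case.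
- apply: cvg_at_right_filter; apply: differentiable_continuous.
  by apply/derivable1_diffP; have := dF 0 (lexx _); case.
- move=> t; rewrite in_itv/= andbT => t0; have h := dF t (ltW t0).
  by rewrite derive1E derive_val.
Unshelve. all: by end_near. Qed.

End decay_integral.

(** * Potential of balls *)

Definition decay_const (R : realType) : R := 4 * (expR 1 * 8`!%:R + 1).

Definition upper_const (R : realType) (d : nat) : R :=
  decay_const R * 4 * (d%:R * exponent_const R d) ^+ 2.

Definition lower_const (R : realType) (d : nat) : R := (4 * tail_const R d)^-1.

Section ball_potential.
Context {R : realType} {d : nat} (hd : (3 <= d)%N).
Context {disp : measure_display} {Omega : measurableType disp}.
Variables (P : probability Omega R) (X : R -> Omega -> 'rV[R]_d).
Variable psi : 'rV[R]_d -> R.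
Hypothesis mX : forall t, 0 <= t -> measurable_fun setT (X t).
Hypothesis cX : {ae P, forall w, cadlag (X ^~ w)}.
Hypothesis iuX : isotropic_unimodal_process P X.
Hypothesis psiX : char_exponent P X psi.
Hypothesis psi0 : exists xi, psi xi != 0.

Let d0 : (0 < d)%N. Proof. exact: leq_trans hd. Qed.

Let M0 : 0 < exponent_const R d.
Proof. exact: lt_le_trans ltr01 (exponent_const_ge1 d0). Qed.

Let psi_star0 r : 0 < r -> 0 < psi_star psi r^-1.
Proof.
by move=> r0; apply: (psi_star_gt0 d0 mX iuX psiX psi0); rewrite invr_gt0.
Qed.

Definition ball_set (r : R) : set 'rV[R]_d := [set x | eucl_norm x <= r].

Lemma measurable_ball_set r : measurable (ball_set r).
Proof. by apply: measurable_le_set => //; exact: measurable_eucl_norm. Qed.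

Lemma potential_measure_mono (A B : set 'rV[R]_d) : measurable A -> measurable B ->
  A `<=` B -> (potential_measure P X A <= potential_measure P X B)%E.
Proof.
move=> mA mB AB.
have [mfA ->] := potential_measureE mX cX mA.
have [mfB ->] := potential_measureE mX cX mB.
apply: ge0_le_integral => //= t; rewrite in_itv/= andbT => t0.
have mpre C : measurable C -> measurable (X t @^-1` C).
  by move=> mC; rewrite -[X in measurable X]setTI; exact: mX.
by apply: le_measure; rewrite ?inE; [exact: mpre|exact: mpre|move=> w; exact: AB].
Qed.

(** Up to a constant, the inverse of the time at which the process leaves the
    ball of radius [r]. *)
Definition kappa (r : R) : R := psi_star psi r^-1 / (d%:R * exponent_const R d) ^+ 2.

Lemma kappa_gt0 r : 0 < r -> 0 < kappa r.
Proof.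
by move=> r0; rewrite divr_gt0 ?psi_star0// exprn_gt0// mulr_gt0 ?ltr0n.
Qed.

Lemma decay_const_gt0 : 0 < (decay_const R).
Proof. by rewrite mulr_gt0// addr_gt0// mulr_gt0 ?expR_gt0// ltr0n fact_gt0. Qed.

Lemma exp_decay (y : R) : 1 <= y -> expR (1 - y ^+ 2) <= expR 1 * 8`!%:R * y ^- 15.
Proof.
move=> y1; have y0 : 0 < y by exact: lt_le_trans y1.
rewrite expRD expRN -mulrA; apply: ler_wpM2l; first exact: expR_ge0.
rewrite ler_pdivlMr ?exprn_gt0// ler_pdivrMl ?expR_gt0//.
apply: (@le_trans _ _ ((y ^+ 2) ^+ 8)); first by rewrite -exprM ler_weXn2l.
rewrite -ler_pdivrMr ?ltr0n ?fact_gt0//.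
by apply: le_trans (expR_ge1Dxn 7 (sqr_ge0 y)); rewrite lerDr.
Qed.

(** Let [y = (1 + kappa t)^(1/12)] and [delta = y^-5 / (d r)]. As [d >= 3], the
    points of the cube which are [delta]-close to a given one occupy at most a
    proportion [y^-15] of it, while at the other frequencies [t psi] is at least
    [y^2 - 1]. Both contributions are thus at most of order [y^-15], a power of
    the time below -1, whence the role of the dimension. *)
Lemma small_ball_decay (t r : R) : 0 <= t -> 0 < r ->
  (P (X t @^-1` ball_set r) <= ((decay_const R) * (1 + kappa r * t) `^ (- (5 / 4)))%:E)%E.
Proof.
move=> t0 r0; have k0 := kappa_gt0 r0.
have b1 : 1 <= 1 + kappa r * t by rewrite lerDl mulr_ge0// ltW.
have b0 : 0 <= 1 + kappa r * t by exact: le_trans b1.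
pose y := (1 + kappa r * t) `^ (1 / 12).
have y12 : y ^+ 12 = 1 + kappa r * t.
  rewrite -powR_mulrn ?powR_ge0// /y -powRrM (_ : 1 / 12 * 12 = 1); last by field.
  by rewrite powRr1.
have y1 : 1 <= y.
  rewrite -(@ler_pXn2r _ 12) ?nnegrE ?powR_ge0// expr1n y12//.
have y0 : 0 < y by exact: lt_le_trans y1.
have yE : (1 + kappa r * t) `^ (- (5 / 4)) = y ^- 15.
  rewrite powRN; congr (_^-1).
  by rewrite -powR_mulrn ?powR_ge0// /y -powRrM; congr (_ `^ _); field.
have dn0 : 0 < d%:R :> R by rewrite ltr0n.
have dr0 : 0 < d%:R * r by rewrite mulr_gt0.
pose delta := y ^- 5 / (d%:R * r).
have y5 : 0 < y ^- 5 by rewrite invr_gt0 exprn_gt0.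
have y51 : y ^- 5 <= 1 by rewrite invf_le1 ?exprn_gt0// exprn_ege1.
have deltaE : d%:R * r * delta = y ^- 5 by rewrite /delta mulrC divfK// gt_eqF.
have delta0 : 0 <= delta by rewrite divr_ge0 ?ltW.
have := @small_ball_fourier R d d0 _ _ P X psi mX psiX t r delta
  (expR (1 - y ^+ 2)) t0 r0 delta0.
rewrite deltaE => /(_ y51 _ _); move=> h.
apply: le_trans (h _ _) _.
- rewrite expR_ge0 expR_le1 subr_le0/= exprn_ege1//.
- move=> z [i hi]; rewrite ler_expR.
  have zd : delta <= eucl_norm z.
    by rewrite (le_trans (ltW hi))// coord_le_eucl_norm.
  have a01 : 0 < y ^- 5 / d%:R <= 1.
    rewrite divr_gt0//= ler_pdivrMr// mul1r (le_trans y51)// ler1n//.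
  have ha : y ^- 5 / d%:R <= r * eucl_norm z.
    apply: (@le_trans _ _ (r * delta)); last by rewrite ler_pM2l.
    rewrite le_eqVlt; apply/orP; left; apply/eqP; rewrite /delta.
    by field; rewrite !gt_eqF.
  have hz := psi_star_le_exponent d0 mX iuX psiX r0 a01 ha.
  have kz : y ^- 10 * kappa r <= psi z.
    rewrite -(ler_pM2l (exprn_gt0 2 M0)) (le_trans _ hz)//.
    rewrite le_eqVlt; apply/orP; left; apply/eqP; rewrite /kappa.
    by field; rewrite !gt_eqF.
  rewrite mulNr lerNl opprB.
  have : t * (y ^- 10 * kappa r) <= t * psi z by apply: ler_wpM2l.
  apply: le_trans.
  rewrite (_ : t * _ = (y ^+ 12 - 1) * y ^- 10); last by rewrite y12; ring.
  rewrite mulrBl mul1r (_ : y ^+ 12 * y ^- 10 = y ^+ 2); last first.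
    by field; rewrite gt_eqF.
  by rewrite lerD2l lerN2 invf_le1 ?exprn_gt0// exprn_ege1.
- rewrite lee_fin yE /decay_const -[leRHS]mulrA ler_pM2l// mulrDl mul1r lerD//.
    exact: exp_decay.
  rewrite -exprVn -exprM exprVn lef_pV2 ?posrE ?exprn_gt0//.
  by rewrite ler_weXn2l// (leq_pmul2l (isT : (0 < 5)%N) : (5 * 3 <= 5 * d)%N = _).
Qed.

Lemma upper_const_gt0 : 0 < (upper_const R d).
Proof.
by rewrite !mulr_gt0 ?decay_const_gt0// ltr0n.
Qed.

Lemma potential_ball_le (r : R) : 0 < r ->
  (potential_measure P X (ball_set r) <= ((upper_const R d) / psi_star psi r^-1)%:E)%E.
Proof.
move=> r0; have k0 := kappa_gt0 r0.
have S0 := psi_star0 r0.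
have C0 := ltW decay_const_gt0.
have [mf ->] := potential_measureE mX cX (measurable_ball_set r).
have mpow : measurable_fun setT (fun t : R => (1 + kappa r * t) `^ (- (5 / 4))).
  apply: (measurableT_comp (measurable_powR _)).
  by apply: measurable_funD => //; apply: measurable_funM.
apply: (@le_trans _ _ (\int[lebesgue_measure]_(t in `[0%R, +oo[)
   ((decay_const R)%:E * ((1 + kappa r * t) `^ (- (5 / 4)))%:E))%E).
  apply: ge0_le_integral => //=.
  - apply: measurable_funTS; apply/measurable_EFinP; exact: measurable_funM.
  - move=> t; rewrite in_itv/= andbT => t0.
    by rewrite -EFinM; exact: small_ball_decay.
rewrite ge0_integralZl//; last 2 first.
- by apply: measurable_funTS; apply/measurable_EFinP.
- by move=> t _; rewrite lee_fin powR_ge0.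
rewrite decay_integral// -EFinM lee_fin le_eqVlt; apply/orP; left; apply/eqP.
have dn0 : 0 < d%:R :> R by rewrite ltr0n.
rewrite /upper_const /kappa; field.
by rewrite !gt_eqF.
Qed.

Lemma tail_const_gt0 : 0 < tail_const R d :> R.
Proof. by rewrite /tail_const mulr_gt0// exprn_gt0// ltr0n. Qed.

Lemma lower_const_gt0 : 0 < (lower_const R d).
Proof. by rewrite invr_gt0 mulr_gt0// tail_const_gt0. Qed.

(** Up to a time of order [1 / psi_star (1 / r)] the process is in the ball with
    probability at least 1/2. *)
Lemma potential_ball_ge (r : R) : 0 < r ->
  (((lower_const R d) / psi_star psi r^-1)%:E <= potential_measure P X (ball_set r))%E.
Proof.
move=> r0; have c0 := tail_const_gt0.
have S0 := psi_star0 r0.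
have [mf ->] := potential_measureE mX cX (measurable_ball_set r).
pose t0 := (2 * tail_const R d * psi_star psi r^-1)^-1.
have t00 : 0 < t0 by rewrite invr_gt0 mulr_gt0// mulr_gt0.
apply: (@le_trans _ _ (\int[lebesgue_measure]_(t in `]0%R, t0]) (1 / 2)%:E)%E).
  have lt0 : lebesgue_measure (`]0%R, t0]%classic : set R) = t0%:E.
    by rewrite lebesgue_measure_itv/= lte_fin t00 -EFinD subr0.
  have -> : (\int[lebesgue_measure]_(t in `]0%R, t0]) (1 / 2)%:E =
      (1 / 2)%:E * t0%:E :> \bar R)%E.
    rewrite -lt0; exact: (integral_cst lebesgue_measure (measurable_itv _) (1 / 2)%:E).
  rewrite -EFinM lee_fin le_eqVlt; apply/orP; left; apply/eqP; rewrite /lower_const /t0.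
  by field; rewrite !gt_eqF.
have sub : (`]0%R, t0]%classic : set R) `<=` `[0%R, +oo[%classic.
  by move=> t /=; rewrite !in_itv/= andbT => /andP[/ltW].
apply: (@le_trans _ _ (\int[lebesgue_measure]_(t in `]0%R, t0])
    P (X t @^-1` ball_set r))%E); last by apply: ge0_subset_integral.
apply: ge0_le_integral => //=.
- exact: measurable_funS mf.
- move=> t; rewrite in_itv/= => /andP[tpos tt0].
  have mB : measurable (X t @^-1` ball_set r).
    rewrite -[X in measurable X]setTI; apply: mX => //; first exact: ltW.
    exact: measurable_ball_set.
  have := tail_probability_le d0 mX iuX psiX tpos r0.
  rewrite (_ : [set w | r < eucl_norm (X t w)] = ~` (X t @^-1` ball_set r)); last first.
    apply/seteqP; split=> w /=; rewrite /ball_set/=.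
      by rewrite ltNge => /negP.
    by move/negP; rewrite -ltNge.
  have [pr prE] : exists pr : R, P (X t @^-1` ball_set r) = pr%:E.
    by exists (fine (P (X t @^-1` ball_set r))); rewrite fineK// fin_num_measure.
  rewrite probability_setC// prE -EFinB !lee_fin => h.
  have : tail_const R d * (t * psi_star psi r^-1) <= 1 / 2; last by lra.
  apply: (@le_trans _ _ (tail_const R d * (t0 * psi_star psi r^-1))).
    by rewrite ler_pM2l// ler_pM2r.
  rewrite le_eqVlt; apply/orP; left; apply/eqP; rewrite /t0.
  by field; rewrite !gt_eqF.
Qed.

End ball_potential.

(** * Bounds on the kernel *)

Section kernel_bounds.
Context {R : realType} {d : nat} (hd : (3 <= d)%N).
Context {disp : measure_display} {Omega : measurableType disp}.
Variables (P : probability Omega R) (X : R -> Omega -> 'rV[R]_d).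
Variables psi G : 'rV[R]_d -> R.
Hypothesis mX : forall t, 0 <= t -> measurable_fun setT (X t).
Hypothesis cX : {ae P, forall w, cadlag (X ^~ w)}.
Hypothesis iuX : isotropic_unimodal_process P X.
Hypothesis psiX : char_exponent P X psi.
Hypothesis psi0 : exists xi, psi xi != 0.
Hypothesis GX : potential_kernel P X G.

Let d0 : (0 < d)%N. Proof. exact: leq_trans hd. Qed.

Let psi_star0 r : 0 < r -> 0 < psi_star psi r^-1.
Proof.
by move=> r0; apply: (psi_star_gt0 d0 mX iuX psiX psi0); rewrite invr_gt0.
Qed.

Let dn0 : 0 < d%:R :> R. Proof. by rewrite ltr0n. Qed.

Let G_mono x y : x != 0 -> eucl_norm x <= eucl_norm y -> G y <= G x /\ 0 <= G x.
Proof.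
have [[g0 [gpos gmono] gE] _] := GX.
move=> x0 xy; have nx : 0 < eucl_norm x by rewrite eucl_norm_gt0.
have y0 : y != 0 by rewrite -eucl_norm_gt0; exact: lt_le_trans xy.
by rewrite !gE//; split; [exact: gmono|exact: gpos].
Qed.

(** The kernel is at least [G x] on the ball of radius [|x|], whose potential is
    at most of order [1 / psi_star (1 / |x|)]. *)
Lemma kernel_upper_bound x : x != 0 ->
  G x <= upper_const R d * d%:R ^+ d / (eucl_norm x ^+ d * psi_star psi (eucl_norm x)^-1).
Proof.
move=> x0; set r := eucl_norm x.
have r0 : 0 < r by rewrite eucl_norm_gt0.
have [_ [N [mN N0 UN]]] := GX.
pose a := r / d%:R; have a0 : 0 < a by rewrite divr_gt0.
(* A box inside the ball of radius |x| that avoids the origin. *)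
pose A : set 'rV[R]_d := box (fun _ => `]0%R, a]%classic).
have mA : measurable A by apply: measurable_box => i; exact: measurable_itv.
have lA : lebesgue_rV R d A = (a ^+ d)%:E.
  rewrite lebesgue_rV_boxE; last by move=> i; exact: measurable_itv.
  rewrite (eq_bigr (fun=> a%:E)).
    by rewrite -(big_morph EFin (@EFinM R) (erefl 1%:E)) prodr_const card_ord.
  by move=> i _; rewrite lebesgue_measure_itv/= lte_fin a0 oppr0 adde0.
have Ax y : A y -> y != 0 /\ eucl_norm y <= r.
  move=> Ay; split.
    apply/eqP => yE; have := Ay (Ordinal d0).
    by rewrite yE /= in_itv/= /rV_coord mxE ltxx.
  have -> : r = d%:R * a by rewrite /a mulrC divfK ?gt_eqF.
  apply: eucl_norm_le_coord; first exact: ltW.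
  move=> i; have := Ay i; rewrite /= in_itv/= => /andP[y0 ya].
  by rewrite ger0_norm// ltW.
have Gx0 : 0 <= G x by have [] := G_mono x0 (lexx _).
have h1 : ((G x * a ^+ d)%:E <= potential_measure P X (A `\` N))%E.
  rewrite UN// EFinM -lA -[A in (_ * _ A)%E]setIT -integral_indic//.
  rewrite -ge0_integralZl//; last by apply/measurable_EFinP; apply: measurable_indic.
  rewrite [leRHS]integral_mkcond; apply: nonneg_integral_mono => y.
    by rewrite -EFinM lee_fin mulr_ge0.
  rewrite patchE indicE; case: ifPn => [/set_mem Ay|_]; last by rewrite mule0.
  rewrite mule1 lee_fin; have [y0 yr] := Ax _ Ay.
  by have [] := G_mono y0 yr.
have h2 : (potential_measure P X (A `\` N) <=
    (upper_const R d / psi_star psi r^-1)%:E)%E.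
  apply: le_trans (potential_ball_le hd mX cX iuX psiX psi0 r0).
  apply: (potential_measure_mono mX cX); first exact: measurableD.
    exact: measurable_ball_set.
  by move=> y [/Ax[]].
have := le_trans h1 h2; rewrite lee_fin -ler_pdivlMr ?exprn_gt0//.
move=> /le_trans; apply; rewrite le_eqVlt; apply/orP; left; apply/eqP.
rewrite /a expr_div_n; field.
by rewrite !gt_eqF ?exprn_gt0// psi_star0.
Qed.

(** The potential measure has no singular part away from the origin, because
    the laws of the process at positive times have none. *)
Lemma potential_measure_null (A N : set 'rV[R]_d) : measurable A -> measurable N ->
  ~ A 0 -> lebesgue_rV R d N = 0%E ->
  (potential_measure P X A <= potential_measure P X (A `\` N))%E.
Proof.
move=> mA mN A0 N0.
have mAN : measurable (A `\` N) by exact: measurableD.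
have [mfA ->] := potential_measureE mX cX mA.
have [mfB ->] := potential_measureE mX cX mAN.
have sub : (`]0%R, +oo[%classic : set R) `<=` `[0%R, +oo[%classic.
  by move=> t /=; rewrite !in_itv/= !andbT => /ltW.
rewrite -(integral_itv_obnd_cbnd (f := fun t => P (X t @^-1` A))); last first.
  exact: measurable_funS mfA.
rewrite -(integral_itv_obnd_cbnd (f := fun t => P (X t @^-1` (A `\` N)))); last first.
  exact: measurable_funS mfB.
rewrite le_eqVlt; apply/orP; left; apply/eqP; apply: eq_integral => t.
move=> /set_mem; rewrite /= in_itv/= andbT => t0.
have [m0 um0 mE] := iuX t0.
have mpre C : measurable C -> measurable (X t @^-1` C).
  by move=> mC; rewrite -[X in measurable X]setTI; apply: mX => //; exact: ltW.
have mAI : measurable (A `&` N) by exact: measurableI.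
rewrite (_ : X t @^-1` A = X t @^-1` (A `\` N) `|` X t @^-1` (A `&` N)); last first.
  by rewrite -preimage_setU setUC setUIDK.
have z : P (X t @^-1` (A `&` N)) = 0%E.
  rewrite -[LHS]/(pushforward P (X t) (A `&` N)) mE//; last by case.
  apply: null_set_integral => //.
    by apply/measurable_EFinP; apply: measurable_profile => //; case.
  exact: subset_measure0 mAI mN (@subIsetr _ _ _) N0.
have -> : P (X t @^-1` (A `\` N) `|` X t @^-1` (A `&` N)) =
    (P (X t @^-1` (A `\` N)) + P (X t @^-1` (A `&` N)))%E.
  apply: measureU; [exact: mpre|exact: mpre|].
  by apply/seteqP; split=> w //= [[_ nN] [_ Nw]].
by rewrite z adde0.
Qed.

(** The kernel is at most [G x] on the shell between the radii [|x|] and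
    [|x| / b]; by hypothesis the inner ball has at most half of the potential of
    the outer one, so that the shell has the other half. *)
Lemma kernel_lower_bound b x : 0 < b -> b <= 1 -> x != 0 ->
  2 * upper_const R d * psi_star psi (b / eucl_norm x) <=
    lower_const R d * psi_star psi (eucl_norm x)^-1 ->
  lower_const R d / 2 ^+ d.+1 * b ^+ d /
    (eucl_norm x ^+ d * psi_star psi (eucl_norm x)^-1) <= G x.
Proof.
move=> b0 b1 x0; set r := eucl_norm x => hS.
have r0 : 0 < r by rewrite eucl_norm_gt0.
have [_ [N [mN N0 UN]]] := GX.
pose L := r / b; have L0 : 0 < L by rewrite divr_gt0.
have rL : r <= L by rewrite ler_pdivlMr// ler_piMr// ltW.
have S1 := psi_star0 r0; have S2 := psi_star0 L0.
have Linv : L^-1 = b / r by rewrite /L invf_div.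
rewrite -Linv in hS.
pose A := ball_set L `\` @ball_set R d r.
have mL := @measurable_ball_set R d L; have mr := @measurable_ball_set R d r.
have mA : measurable A by exact: measurableD.
have A0 : ~ A 0.
  by move=> [_]; apply; rewrite /ball_set/= eucl_norm0 ltW.
have split_ball : (potential_measure P X (ball_set L) <=
    potential_measure P X A + potential_measure P X (ball_set r))%E.
  have [mfL ->] := potential_measureE mX cX mL.
  have [mfr ->] := potential_measureE mX cX mr.
  have [mfA ->] := potential_measureE mX cX mA.
  rewrite -ge0_integralD//.
  apply: ge0_le_integral => //=; first exact: emeasurable_funD.
  move=> t; rewrite in_itv/= andbT => t0.
  have mpre C : measurable C -> measurable (X t @^-1` C).
    by move=> mC; rewrite -[X in measurable X]setTI; exact: mX.
  apply: le_trans (measureU2 _ (mpre _ mA) (mpre _ mr)).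
  apply: le_measure; rewrite ?inE; [exact: mpre|by apply: measurableU; exact: mpre|].
  by move=> w /= Lw; case: (pselect (ball_set r (X t w))) => h; [right|left].
have Gx0 : 0 <= G x by have [] := G_mono x0 (lexx _).
have hA : (potential_measure P X A <= (G x * (2 * L) ^+ d)%:E)%E.
  apply: le_trans (potential_measure_null mA mN A0 N0) _.
  have lC := @lebesgue_cube R d 0 L (ltW L0).
  have mC := @measurable_cube R d 0 L.
  rewrite UN// EFinM -lC -[X in (_ * _ X)%E]setIT -integral_indic//.
  rewrite -ge0_integralZl//; last by apply/measurable_EFinP; apply: measurable_indic.
  rewrite [leLHS]integral_mkcond; apply: nonneg_integral_mono => y.
    rewrite patchE; case: ifPn => // /set_mem Ay; rewrite lee_fin.
    have y0 : y != 0 by apply: contra_notN A0 => /eqP <-.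
    by have [] := G_mono y0 (lexx _).
  rewrite patchE indicE; case: ifPn => [/set_mem Ay|_]; last first.
    by rewrite -EFinM lee_fin mulr_ge0.
  case: Ay => /= Ly /negP; rewrite -ltNge => ry.
  rewrite mem_set; last first.
    by apply/cubeP => i; rewrite mxE subr0 (le_trans (coord_le_eucl_norm _ _)).
  by rewrite mule1 lee_fin; have [] := G_mono x0 (ltW ry).
have lo := potential_ball_ge hd mX cX iuX psiX psi0 L0.
have up := potential_ball_le hd mX cX iuX psiX psi0 r0.
have := le_trans (le_trans lo split_ball) (leeD hA up).
rewrite -EFinD lee_fin => h.
set S := psi_star psi r^-1 in S1 hS h up *; set T := psi_star psi L^-1 in S2 hS h lo *.
have TS : T <= S.
  apply: (psi_star_mono d0 mX iuX psiX); first by rewrite invr_gt0.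
  by rewrite lef_pV2 ?posrE.
have c0 := @lower_const_gt0 R d hd.
have h3 : upper_const R d / S <= lower_const R d / T / 2.
  rewrite ler_pdivrMr// (_ : _ / 2 * S = lower_const R d * S / (2 * T)); last first.
    by field; rewrite gt_eqF.
  by rewrite ler_pdivlMr ?mulr_gt0// mulrCA mulrA.
have h4 : lower_const R d / S <= lower_const R d / T.
  by rewrite ler_pM2l// lef_pV2 ?posrE.
have h5 : lower_const R d / S / 2 <= G x * (2 * L) ^+ d by lra.
rewrite (_ : lower_const R d / _ * _ / _ = lower_const R d / S / 2 / (2 * L) ^+ d).
  by rewrite ler_pdivrMr// exprn_gt0// mulr_gt0.
rewrite /L exprMn expr_div_n exprS; field.
by rewrite !gt_eqF ?exprn_gt0.
Qed.

End kernel_bounds.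

(** * The scaling condition *)

Section scaling_constant.
Context {R : realType} {d : nat} (hd : (3 <= d)%N).

(** Large enough for the ball of radius [r / b] to have at least twice the
    potential of the ball of radius [r] when [b ^ beta = Cstar / ratio_const]. *)
Definition ratio_const : R :=
  2 + 2 * upper_const R d * exponent_const R d / lower_const R d.

Let d0 : (0 < d)%N. Proof. exact: leq_trans hd. Qed.

Lemma ratio_const_gt1 : 1 < ratio_const.
Proof.
have h : 0 <= 2 * upper_const R d * exponent_const R d / lower_const R d.
  have U0 := ltW (@upper_const_gt0 R d hd); have l0 := ltW (@lower_const_gt0 R d hd).
  have M0 : 0 <= exponent_const R d := le_trans ler01 (exponent_const_ge1 d0).
  exact: divr_ge0 (mulr_ge0 (mulr_ge0 (ler0n _ _) U0) M0) l0.
by rewrite /ratio_const; lra.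
Qed.

(** The scaling condition for the dilation of ratio 1. *)
Lemma WLSC_const_le1 (beta theta Cstar : R) (psi : 'rV[R]_d -> R) :
  WLSC beta theta Cstar psi -> Cstar <= 1.
Proof.
move=> [psi0 h]; have [x xE] := @exists_eucl_norm R d (`|theta| + 1) d0 (addr_ge0 (normr_ge0 _) ler01).
have x0 : x != 0 by rewrite -eucl_norm_gt0 xE ltr_wpDl.
have := h 1 x (lexx _) x0; rewrite powR1 mulr1 scale1r xE.
rewrite (le_trans (ler_norm theta)) ?lerDl// => /(_ isT).
by rewrite -ler_pdivlMr ?psi0// divff// gt_eqF// psi0.
Qed.

Lemma scaling_radius (beta Cstar : R) : 0 < beta -> 0 < Cstar -> Cstar <= 1 ->
  let b := ratio_const `^ (- beta^-1) * Cstar `^ beta^-1 in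
  [/\ 0 < b, b < 1 & b^-1 `^ beta = ratio_const / Cstar].
Proof.
move=> beta0 C0 C1 b.
have K0 : 0 < ratio_const by exact: lt_trans ltr01 ratio_const_gt1.
have b0 : 0 < b by rewrite mulr_gt0// powR_gt0.
have bE : b^-1 `^ beta = ratio_const / Cstar.
  have e : b `^ beta = ratio_const^-1 * Cstar.
    rewrite /b powRM ?powR_ge0// -!powRrM mulNr mulVf ?gt_eqF//.
    by rewrite powRr1 ?ltW// powR_inv1 ?ltW.
  rewrite -powR_inv1 ?ltW// -powRrM mulrC powRrM e powR_inv1 ?invfM ?invrK//.
  by rewrite mulr_ge0 ?invr_ge0 ?ltW.
split => //.
rewrite ltNge; apply/negP => b1.
have : b^-1 `^ beta <= 1.
  rewrite [leRHS](_ : 1 = 1 `^ beta); last by rewrite powR1.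
  apply: ge0_ler_powR; rewrite ?nnegrE ?invr_ge0 ?(ltW beta0) ?(ltW b0)//.
  by rewrite invf_le1.
rewrite bE ler_pdivrMr// mul1r leNgt.
by rewrite (le_lt_trans C1)// ratio_const_gt1.
Qed.

End scaling_constant.

Theorem theorem3 (R : realType) (d : nat) (hd : (3 <= d)%N) :
  exists (C4 c5 : R) (c : R -> R),
    [/\ 0 < C4, 0 < c5, forall beta : R, 0 < beta -> 0 < c beta &
    forall (disp : measure_display) (Omega : measurableType disp)
      (P : probability Omega R) (X : R -> Omega -> 'rV[R]_d)
      (psi G : 'rV[R]_d -> R),
    levy_process P X ->
    isotropic_unimodal_process P X ->
    char_exponent P X psi ->
    (exists xi, psi xi != 0) ->
    potential_kernel P X G ->
    (forall x : 'rV[R]_d, x != 0 ->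
      G x <= C4 / (eucl_norm x ^+ d * psi_star psi (eucl_norm x)^-1)) /\
    (forall (rho : \bar R) (beta Cstar : R),
      (0 < rho)%E -> 0 < beta -> 0 < Cstar ->
      WLSC beta (fine rho^-1%E) Cstar psi ->
      let b := c beta * Cstar `^ beta^-1 in
      let C5 := c5 * b ^+ d in
      b < 1 /\
      forall x : 'rV[R]_d, 0 < eucl_norm x ->
        ((eucl_norm x)%:E <= b%:E * rho)%E ->
        C5 / (eucl_norm x ^+ d * psi_star psi (eucl_norm x)^-1) <= G x)].
Proof.
have d0 : (0 < d)%N by exact: leq_trans hd.
have U0 := @upper_const_gt0 R d hd; have l0 := @lower_const_gt0 R d hd.
have M0 : 0 < exponent_const R d := lt_le_trans ltr01 (exponent_const_ge1 d0).
have K0 : 0 < @ratio_const R d := lt_trans ltr01 (ratio_const_gt1 hd).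
exists (upper_const R d * d%:R ^+ d), (lower_const R d / 2 ^+ d.+1),
  (fun beta => @ratio_const R d `^ (- beta^-1)).
split.
- by rewrite mulr_gt0// exprn_gt0// ltr0n.
- by rewrite divr_gt0// exprn_gt0.
- by move=> beta beta0; exact: powR_gt0.
move=> disp Omega P X psi G [mX _ _ _ _ cX] iuX psiX psi0 GX; split.
  by move=> x x0; exact: (kernel_upper_bound hd mX cX iuX psiX psi0 GX x0).
move=> rho beta Cstar rho0 beta0 C0 wlsc b C5.
have [b0 b1 bE] := scaling_radius hd beta0 C0 (WLSC_const_le1 hd wlsc).
split=> // x r0 xrho; have x0 : x != 0 by rewrite -eucl_norm_gt0.
apply: (kernel_lower_bound hd mX cX iuX psiX psi0 GX b0 (ltW b1) x0).
set r := eucl_norm x in r0 xrho *.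
have br0 : 0 < b / r by rewrite divr_gt0.
have [y yE] := @exists_eucl_norm R d (b / r) d0 (ltW br0).
have y0 : y != 0 by rewrite -eucl_norm_gt0 yE.
have theta_le : fine rho^-1%E <= eucl_norm y.
  rewrite yE; case: rho rho0 xrho {wlsc} => [rho||]//= rho0 xrho; last by rewrite ltW.
  move: rho0 xrho; rewrite lte_fin -EFinM lee_fin => rho0 xrho.
  rewrite fine_invr ler_pdivlMr// mulrC ler_pdivrMr//.
have hW := wlsc.2 b^-1 y _ y0 theta_le.
have {}hW : Cstar * b^-1 `^ beta * psi y <= psi (b^-1 *: y).
  by apply: hW; rewrite invf_ge1// ltW.
rewrite bE mulrCA divff ?gt_eqF// mulr1 in hW.
have h1 : psi (b^-1 *: y) <= psi_star psi r^-1.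
  apply: (psi_star_ub d0 mX iuX psiX); first by rewrite invr_gt0.
  by rewrite eucl_normZ yE gtr0_norm ?invr_gt0// mulrA mulVf ?gt_eqF// mul1r.
have h2 := psi_star_le d0 mX iuX psiX yE.
have psiy : 0 < psi y := exponent_gt0 d0 mX iuX psiX psi0 y0.
apply: (@le_trans _ _ (lower_const R d * (@ratio_const R d * psi y))); last first.
  by rewrite ler_pM2l// (le_trans hW).
apply: (@le_trans _ _ (2 * upper_const R d * (exponent_const R d * psi y))).
  by rewrite ler_pM2l// mulr_gt0.
rewrite [leRHS](_ : _ = 2 * lower_const R d * psi y +
    2 * upper_const R d * (exponent_const R d * psi y)).
  by rewrite lerDr !mulr_ge0 ?ltW.
by rewrite /ratio_const; field; rewrite gt_eqF.
Qed.
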